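(* Let $t:\Sigma^*\to\Omega^*$ be a rational (partial) function whose domain $X=\mathrm{dom}(t)$ is suffix-closed. If $X$ contains no linear fooling set for $t$ and $t(X)$ is bounded, then the $\overleftarrow{t}$-growth of $X$ is polynomial. Otherwise the $\overleftarrow{t}$-growth of $X$ is exponential.
   Context: A partial function $t:\Sigma^*\to\Omega^*$ is rational if its graph $\{(x,t(x))\}$ is a rational subset of the monoid $\Sigma^*\times\Omega^*$ (accepted by a finite transducer). A language is suffix-closed if it contains all suffixes of its words. For a partial function $t$ with suffix-closed domain, its suffix expansion $\overleftarrow{t}:\mathrm{dom}(t)\to(\Omega^* )^*$ maps $a_1\cdots a_n$ to the finite sequence $(t(a_1\cdots a_n),t(a_2\cdots a_n),\dots,t(a_n))$. For a partial function $f:\Sigma^*\to Y$ and $X\subseteq\mathrm{dom}(f)$, the $f$-growth of $X$ is $\gamma(n)=|f(X\cap\Sigma^{\le n})|$. A function $\gamma:\mathbb N\to\mathbb N$ grows polynomially if $\gamma(n)\in O(n^k)$ for some $k$, and exponentially if there is $c>1$ with $\gamma(n)\ge c^n$ for infinitely many $n$. A language $K$ is bounded if $K\subseteq w_1^*\cdots w_k^*$ for some words $w_1,\dots,w_k$. A linear fooling scheme for $t$ is a tuple $(u_2,v_2,u,v,Z)$ with $u_2,v_2,u,v\in\Sigma^*$, $Z\subseteq\Sigma^*$, such that $u_2$ is a suffix of $u$, $v_2$ is a suffix of $v$, $|u_2|=|v_2|$, $\{u_2,v_2\}\{u,v\}^*Z\subseteq\mathrm{dom}(t)$, and there is a constant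 $c$ such that for every $n\in\mathbb N$ there exists $z_n\in Z$ with $|z_n|\le cn$ (for all large $n$, i.e. $|z_n|\in O(n)$) and $t(u_2wz_n)\neq t(v_2wz_n)$ for all $w\in\{u,v\}^{\le n}$. The set $\{u_2,v_2\}\{u,v\}^*Z$ is then called a linear fooling set for $t$; ''$X$ contains a linear fooling set for $t$'' means some linear fooling set for $t$ is a subset of $X$. *)

(* Defs.v *)
From Stdlib Require Import Reals.
From mathcomp Require Import all_boot.

Set Implicit Arguments.
Unset Strict Implicit.
Unset Printing Implicit Defensive.

Record transducer (Sigma Omega : finType) := Transducer {
  tr_state : finType;
  tr_init  : pred tr_state;
  tr_final : pred tr_state;
  tr_delta : seq (tr_state * seq Sigma * seq Omega * tr_state)
}.

Inductive tr_run (Sigma Omega : finType) (T : transducer Sigma Omega) :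
    tr_state T -> seq Sigma -> seq Omega -> tr_state T -> Prop :=
  | tr_run_nil p : @tr_run Sigma Omega T p [::] [::] p
  | tr_run_cons p u v q x y r :
      List.In (p, u, v, q) (tr_delta T) ->
      @tr_run Sigma Omega T q x y r -> @tr_run Sigma Omega T p (u ++ x) (v ++ y) r.

Definition tr_accepts (Sigma Omega : finType) (T : transducer Sigma Omega)
    (x : seq Sigma) (y : seq Omega) : Prop :=
  exists p q, @tr_init _ _ T p /\ @tr_final _ _ T q /\ @tr_run Sigma Omega T p x y q.

Definition rational_fun (Sigma Omega : finType)
    (t : seq Sigma -> option (seq Omega)) : Prop :=
  exists T : transducer Sigma Omega,
    forall x y, tr_accepts T x y <-> t x = Some y.

Definition dom (Sigma : finType) (Y : Type) (t : seq Sigma -> option Y)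
    : seq Sigma -> Prop := fun x => t x <> None.

Definition img (Sigma : finType) (Y : Type) (t : seq Sigma -> option Y)
    : Y -> Prop := fun y => exists x, t x = Some y.

Definition suffix_closed (Sigma : finType) (L : seq Sigma -> Prop) : Prop :=
  forall x y, L (x ++ y) -> L y.

(* Suffix expansion: a_1..a_n |-> (t(a_1..a_n), t(a_2..a_n), ..., t(a_n)).
   (Only used on dom t, which is suffix-closed, so the default is never hit.) *)
Definition suffix_expansion (Sigma Omega : finType)
    (t : seq Sigma -> option (seq Omega)) (x : seq Sigma) : seq (seq Omega) :=
  [seq odflt [::] (t (drop i x)) | i <- iota 0 (size x)].

Definition words_le (Sigma : finType) (n : nat) : seq (seq Sigma) :=
  flatten [seq [seq val w | w <- enum {: k.-tuple Sigma}] | k <- iota 0 n.+1].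

Definition growth (Sigma : finType) (Y : eqType) (f : seq Sigma -> Y)
    (X : pred (seq Sigma)) (n : nat) : nat :=
  size (undup [seq f x | x <- words_le Sigma n & X x]).

Definition grows_polynomially (g : nat -> nat) : Prop :=
  exists (k C N : nat), forall n, N <= n -> g n <= C * n ^ k.

Definition grows_exponentially (g : nat -> nat) : Prop :=
  exists c : R, Rlt 1 c /\
    forall N, exists n, N <= n /\ Rle (Rpow_def.pow c n) (INR (g n)).

Definition power_word (A : Type) (w : seq A) (m : nat) : seq A :=
  flatten (nseq m w).

Definition bounded_lang (A : Type) (K : seq A -> Prop) : Prop :=
  exists ws : seq (seq A), forall y, K y ->
    exists ms : seq nat, size ms = size ws /\
      y = flatten [seq power_word p.2 p.1 | p <- zip ms ws].

Definition in_pow_le (A : Type) (u v : seq A) (n : nat) (w : seq A) : Prop :=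
  exists s : seq bool, size s <= n /\
    w = flatten [seq (if b then u else v) | b <- s].

Definition in_star2 (A : Type) (u v : seq A) (w : seq A) : Prop :=
  exists s : seq bool, w = flatten [seq (if b then u else v) | b <- s].

Definition linear_fooling_scheme (Sigma Omega : finType)
    (t : seq Sigma -> option (seq Omega))
    (u2 v2 u v : seq Sigma) (Z : seq Sigma -> Prop) : Prop :=
  [/\ suffix u2 u, suffix v2 v, size u2 = size v2,
      (forall w z, in_star2 u v w -> Z z ->
         dom t (u2 ++ w ++ z) /\ dom t (v2 ++ w ++ z)) &
      exists c N : nat, forall n : nat, exists z, Z z /\
         (N <= n -> size z <= c * n) /\
         forall w, in_pow_le u v n w -> t (u2 ++ w ++ z) <> t (v2 ++ w ++ z)].

Definition fooling_set (Sigma : finType) (u2 v2 u v : seq Sigma)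
    (Z : seq Sigma -> Prop) : seq Sigma -> Prop :=
  fun x => exists p w z, (p = u2 \/ p = v2) /\ in_star2 u v w /\ Z z /\
                         x = p ++ w ++ z.

Definition contains_linear_fooling_set (Sigma Omega : finType)
    (t : seq Sigma -> option (seq Omega)) (X : seq Sigma -> Prop) : Prop :=
  exists u2 v2 u v Z, linear_fooling_scheme t u2 v2 u v Z /\
    (forall x, fooling_set u2 v2 u v Z x -> X x).

(* Main.v *)
(** Read from right to left, a rational function is computed by a deterministic
    device with finitely many control states and registers: reading a letter
    replaces each register by a copy of an older one with a word prepended, and
    the output is the content of one register.

    The control state is enriched so as to remember, for every pair of registers,
    what remains of their contents after removing the longest common suffix,
    until this difference exceeds a bound.  Let [u], [v] be loops at an enriched
    state reached by [x], and [a], [b] suffixes of [u], [v] of the same length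
    with [t (a x) <> t (b x)]; both outputs are read from a pair of registers.
    If their difference is remembered, it is the same after every word of
    [{u, v}*] and [{x}] completes a fooling scheme.  Otherwise follow the pair
    backwards through a loop [e] whose copying map has minimal rank.  If this
    leads to a pair with unbounded difference, then a suitable power of [e u],
    [e v] always copies from that pair, which is pumped to a difference larger
    than anything that words of [{u, v}^{<= n}] can prepend.  If it leads to a
    pair with bounded, hence remembered, difference, then [e] itself contains a
    factor that can be pumped to make the difference large for good.  In each case
    there is a linear fooling scheme.

    Hence, without such schemes, inside a strongly connected component of
    enriched states the outputs are determined by the length of the word and the
    registers at the entry of the component.  There are boundedly many components
    on a run, and polynomially many contents of registers when the image is
    bounded.  Conversely, a fooling scheme yields [2^n] suffix expansions of words
    of linear length, and so do two loops at the same register that write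
    non-commuting words; if the words written by loops always commute, they are
    powers of one word for each state and register and the image is bounded. *)

Require Import Defs.
From Stdlib Require Import Reals Lra.
From mathcomp Require Import all_boot zify boolp.
Set Implicit Arguments.
Unset Strict Implicit.
Unset Printing Implicit Defensive.

(** * Words *)

Section Words.
Variable A : finType.
Implicit Types s t u v w : seq A.

Fixpoint strip s t : seq A * seq A :=
  match s, t with
  | a :: s', b :: t' => if a == b then strip s' t' else (s, t)
  | _, _ => (s, t)
  end.

Lemma strip_id s : strip s s = ([::], [::]).
Proof. by elim: s => //= a s ->; rewrite eqxx. Qed.

Lemma strip_inj s t : strip s t = ([::], [::]) -> s = t.
Proof.
elim: s t => [|a s IH] [|b t] //=; case: eqP => // -> e.
by rewrite (IH t).
Qed.

(** Letters stripped once stay stripped, so what remains suffices to continue. This is why a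
    difference of registers can be updated letter by letter. *)
Lemma strip_cat s t u v :
  strip (s ++ u) (t ++ v) = strip ((strip s t).1 ++ u) ((strip s t).2 ++ v).
Proof.
elim: s t => [|a s IH] [|b t] //=.
by case: eqP => [_|ne] //=; case: eqP.
Qed.

(** Two nonempty remainders begin with different letters, which block any further stripping. *)
Lemma strip_stuck s t u v :
  (strip s t).1 != [::] -> (strip s t).2 != [::] ->
  strip (s ++ u) (t ++ v) = ((strip s t).1 ++ u, (strip s t).2 ++ v).
Proof.
elim: s t => [|a s IH] [|b t] //=; case: (eqVneq a b) => _ /=; [exact: IH | by []].
Qed.

Lemma size_strip s t :
  size s + size (strip s t).2 = size t + size (strip s t).1.
Proof.
elim: s t => [|a s IH] [|b t] //=; rewrite ?addn0 //.
by case: (eqVneq a b) => _ /=; [have := IH t; lia | lia].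
Qed.

Lemma size_strip_le s t : size (strip s t).1 <= size s.
Proof.
elim: s t => [|a s IH] [|b t] //=; case: (eqVneq a b) => _ //=.
exact: leq_trans (IH t) _.
Qed.

(* What remains of [s] and [t], both reversed, without the longest common suffix. *)
Definition delta s t := strip (rev s) (rev t).
Definition dist s t := size (delta s t).1 + size (delta s t).2.

Lemma delta_cat u v s t :
  delta (u ++ s) (v ++ t)
  = strip ((delta s t).1 ++ rev u) ((delta s t).2 ++ rev v).
Proof. by rewrite /delta !rev_cat strip_cat. Qed.

Lemma size_delta s t :
  size s + size (delta s t).2 = size t + size (delta s t).1.
Proof. by have := size_strip (rev s) (rev t); rewrite !size_rev. Qed.

Lemma delta_inj s t : delta s t = ([::], [::]) -> s = t.
Proof. by move=> /strip_inj /(congr1 rev); rewrite !revK. Qed.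

Lemma dist_id s : dist s s = 0.
Proof. by rewrite /dist /delta strip_id. Qed.

Lemma dist_size s t : size s <= size t + dist s t.
Proof. by have := size_delta s t; rewrite /dist; lia. Qed.

Lemma dist_size_sym s t : size t <= size s + dist s t.
Proof. by have := size_delta s t; rewrite /dist; lia. Qed.

Lemma dist_stuck u v s t :
  (delta s t).1 != [::] -> (delta s t).2 != [::] ->
  dist (u ++ s) (v ++ t) = dist s t + size u + size v.
Proof.
move=> n1 n2; rewrite /dist /delta !rev_cat strip_stuck //= !size_cat !size_rev.
rewrite -/(delta s t); lia.
Qed.

(** With an empty remainder, one of the words is a suffix of the other, and only their lengths
    count. *)
Lemma dist_nstuck s t :
  ~~ (((delta s t).1 != [::]) && ((delta s t).2 != [::])) ->
  dist s t = (size s - size t) + (size t - size s).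
Proof.
have := size_delta s t; rewrite /dist.
by case: (delta s t) => [[|a d] [|b d']] //=; lia.
Qed.

Lemma dist_cat_le u v s t :
  dist (u ++ s) (v ++ t) <= dist s t + size u + size v.
Proof.
have [/andP[]|n] := boolP (((delta s t).1 != [::]) && ((delta s t).2 != [::])).
  by move=> n1 n2; rewrite dist_stuck.
rewrite {1}/dist delta_cat /dist.
set d := delta s t; set x := _ ++ rev u; set y := _ ++ rev v.
have := size_strip x y; have := size_strip_le x y.
by rewrite /x /y !size_cat !size_rev; lia.
Qed.

Lemma dist_cat_ge u v s t :
  dist s t <= dist (u ++ s) (v ++ t) + size u + size v.
Proof.
have [/andP[]|n] := boolP (((delta s t).1 != [::]) && ((delta s t).2 != [::])).
  by move=> n1 n2; rewrite dist_stuck //; lia.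
rewrite (dist_nstuck n).
by have := dist_size (u ++ s) (v ++ t); have := dist_size_sym (u ++ s) (v ++ t);
   rewrite !size_cat; lia.
Qed.

Lemma dist_cat_eq u v s t : u ++ s = v ++ t -> dist s t <= size u + size v.
Proof. by move=> e; have := dist_cat_ge u v s t; rewrite e dist_id; lia. Qed.


(** * Powers and commuting words *)

Lemma power_wordS w n : power_word w n.+1 = w ++ power_word w n. Proof. by []. Qed.

Lemma size_power_word w n : size (power_word w n) = n * size w.
Proof. by elim: n => //= n IH; rewrite power_wordS size_cat IH mulSn. Qed.

Lemma comm_power_word x s k : x ++ s = s ++ x ->
  x ++ power_word s k = power_word s k ++ x.
Proof.
move=> e; elim: k => [|k IH]; first by rewrite cats0.
by rewrite power_wordS catA e -catA IH catA.
Qed.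

(* The root is a shortest nonempty word commuting with [s]. *)
Lemma comm_root s : s != [::] ->
  exists w, forall x, x ++ s = s ++ x -> exists m, x = power_word w m.
Proof.
move=> sN.
pose P n := `[< exists w, [/\ w != [::], size w = n & w ++ s = s ++ w] >].
have exP : exists n, P n by exists (size s); apply/asboolP; exists s.
case: (ex_minnP exP) => n /asboolP [w [wN sw ws]] min.
exists w => x; have [l] := ubnP (size x); elim: l x => // l IH x lx xs.
have [->|xN] := eqVneq x [::]; first by exists 0.
have lwx : size w <= size x.
  by rewrite sw; apply: min; apply/asboolP; exists x.
have s_gt0 : 0 < size s by rewrite lt0n size_eq0.
(* Words commuting with [s] are prefixes of powers of [s]; hence the shorter word [w] is a prefix of
   [x] and can be split off. *)
have take_pow y : y ++ s = s ++ y -> size y <= size x ->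
    y = take (size y) (power_word s (size x)).
  move=> ys le; have := comm_power_word (size x) ys.
  move/(congr1 (take (size y))); rewrite take_size_cat // takel_cat //.
  rewrite size_power_word; nia.
have e : x = w ++ drop (size w) x.
  rewrite {1}(take_pow x xs (leqnn _)) {1}(take_pow w ws lwx).
  rewrite -{1}(cat_take_drop (size w) (take _ (power_word s _))) take_takel //.
  by rewrite -(take_pow x xs (leqnn _)).
set x' := drop _ _ in e.
have lx' : size x' < l.
  have : 0 < size w by rewrite lt0n size_eq0.
  by move: lx; rewrite e size_cat; lia.
have xs' : x' ++ s = s ++ x'.
  move: xs; rewrite e -catA => xs.
  have : w ++ (x' ++ s) = w ++ (s ++ x') by rewrite xs !catA ws.
  by move/eqP; rewrite eqseq_cat // eqxx => /eqP.
have [m em] := IH x' lx' xs'.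
by exists m.+1; rewrite e em power_wordS.
Qed.

End Words.

(* On the indices that satisfy [b], [d] is a function of the vertex [v i]; hence it
   increases only when a new vertex is met. *)
Lemma potential_bound (V : finType) (v : nat -> V) (b : pred nat)
    (d : nat -> nat) M c N :
  d 0 <= M ->
  (forall i, i < N -> d i.+1 <= d i + c) ->
  (forall i, i <= N -> ~~ b i -> d i <= M) ->
  (forall i k, i < k <= N -> b i -> b k -> v i = v k -> d i = d k) ->
  forall i, i <= N -> d i <= M + c * #|V|.
Proof.
move=> d0 dS dM dv i iN.
pose T i := [set v m | m : 'I_i.+1 & b m].
have TS j k : j <= k -> T j \subset T k.
  move=> jk; apply/subsetP=> _ /imsetP[m + ->]; rewrite inE => bm.
  by apply/imsetP; exists (widen_ord (jk : j.+1 <= k.+1) m) => //; rewrite inE.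
suff: d i <= M + c * #|T i|.
  by move=> H; apply: (leq_trans H); rewrite leq_add2l leq_mul2l max_card orbT.
have [n] := ubnP i; elim: n i iN => // n IH [|i] iN; first by move=> _; lia.
rewrite ltnS => le_i.
have [bi|nbi] := boolP (b i.+1); last by have := dM _ iN nbi; lia.
have [/imsetP[m]|vN] := boolP (v i.+1 \in T i).
  rewrite inE => bm e.
  rewrite -(dv m i.+1 _ bm bi (esym e)); last by rewrite ltn_ord iN.
  have lm := ltn_ord m.
  apply: leq_trans (IH m _ _) _; [lia | lia |].
  by rewrite leq_add2l leq_mul2l subset_leq_card ?orbT //; apply: TS; lia.
have : #|T i| < #|T i.+1|.
  apply: proper_card; apply/properP; split; first exact: TS.
  by exists (v i.+1) => //; apply/imsetP; exists ord_max; rewrite ?inE.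
by have := dS i iN; have := IH i (ltnW iN) le_i; nia.
Qed.

(** * Register machines *)

Lemma cat_congr (A T : Type) (s : seq A -> T) :
  (forall a x y, s x = s y -> s (a :: x) = s (a :: y)) ->
  forall u x y, s x = s y -> s (u ++ x) = s (u ++ y).
Proof. by move=> s_cons u x y e; elim: u => //= a u; apply: s_cons. Qed.

(* Words are read from the right, so that [a :: x] is one step after [x].  The set
   [act x] of the registers in use doubles as control state; [preP] says that the
   content of a register in use can still be observed in an output. *)
Record machine (Sigma Omega : finType) (t : seq Sigma -> option (seq Omega)) :=
  Machine {
  reg : finType;
  act : seq Sigma -> {set reg};
  rval : reg -> seq Sigma -> seq Omega;
  src : {set reg} -> Sigma -> reg -> reg;
  label : {set reg} -> Sigma -> reg -> seq Omega;
  out : {set reg} -> option reg;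
  pre : reg -> seq Sigma;
  prew : reg -> seq Omega;
  act_cons : forall a x y, act x = act y -> act (a :: x) = act (a :: y);
  src_act : forall a x k, k \in act (a :: x) -> src (act x) a k \in act x;
  rval_cons : forall a x k, k \in act (a :: x) ->
    rval k (a :: x) = label (act x) a k ++ rval (src (act x) a k) x;
  outP : forall x, if out (act x) is Some k
                   then k \in act x /\ t x = Some (rval k x) else t x = None;
  preP : forall k x, k \in act x -> t (pre k ++ x) = Some (prew k ++ rval k x) }.

Section Runs.
Variables (Sigma Omega : finType) (t : seq Sigma -> option (seq Omega)).
Variable m : machine t.
Implicit Types (u v x y z : seq Sigma) (g h : reg m).
Local Notation act := (act m).
Local Notation rval := (@rval _ _ _ m).

Fixpoint origin u x k :=
  if u is a :: u' then origin u' x (src (act (u' ++ x)) a k) else k.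

Fixpoint written u x k : seq Omega :=
  if u is a :: u'
  then label (act (u' ++ x)) a k ++ written u' x (src (act (u' ++ x)) a k)
  else [::].

Definition max_label :=
  \max_(p : {set reg m} * Sigma * reg m) size (label p.1.1 p.1.2 p.2).

Lemma act_cat u x y : act x = act y -> act (u ++ x) = act (u ++ y).
Proof. exact: cat_congr (@act_cons _ _ _ m) _ _ _. Qed.

Lemma origin_congr u x y k : act x = act y -> origin u x k = origin u y k.
Proof. by move=> e; elim: u k => //= a u IH k; rewrite (act_cat u e) IH. Qed.

Lemma written_congr u x y k : act x = act y -> written u x k = written u y k.
Proof. by move=> e; elim: u k => //= a u IH k; rewrite (act_cat u e) IH. Qed.

Lemma origin_act u x k : k \in act (u ++ x) -> origin u x k \in act x.
Proof. by elim: u k => //= a u IH k /src_act; apply: IH. Qed.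

Lemma rval_cat u x k : k \in act (u ++ x) ->
  rval k (u ++ x) = written u x k ++ rval (origin u x k) x.
Proof.
elim: u k => //= a u IH k kA; rewrite rval_cons // IH ?catA //.
exact: src_act.
Qed.

Lemma origin_cat u v x k : origin (u ++ v) x k = origin v x (origin u (v ++ x) k).
Proof. by elim: u k => //= a u IH k; rewrite IH catA. Qed.

Lemma written_cat u v x k :
  written (u ++ v) x k = written u (v ++ x) k ++ written v x (origin u (v ++ x) k).
Proof. by elim: u k => //= a u IH k; rewrite IH -!catA. Qed.

Lemma size_written u x k : size (written u x k) <= max_label * size u.
Proof.
elim: u k => //= a u IH k; rewrite size_cat mulnS leq_add //.
exact: (leq_bigmax (F := fun p => size (label p.1.1 p.1.2 p.2))
          ((act (u ++ x), a), k)).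
Qed.

(** * Pumping a loop to drive two registers apart *)

Section Pump.
Variables (F : finType) (s : seq Sigma -> F).
Hypothesis s_cons : forall a x y, s x = s y -> s (a :: x) = s (a :: y).
Hypothesis s_act : forall x y, s x = s y -> act x = act y.

Lemma s_power_word y z n : s (y ++ z) = s z -> s (power_word y n ++ z) = s z.
Proof.
by move=> e; elim: n => //= n IH; rewrite power_wordS -catA (cat_congr s_cons y IH).
Qed.

Lemma origin_power_word y z n k : s (y ++ z) = s z -> origin y z k = k ->
  origin (power_word y n) z k = k.
Proof.
move=> e f; elim: n => //= n IH; rewrite power_wordS origin_cat.
by rewrite (origin_congr y k (s_act (s_power_word n e))) f.
Qed.

Lemma written_power_word y z n k : s (y ++ z) = s z -> origin y z k = k ->
  written (power_word y n) z k = power_word (written y z k) n.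
Proof.
move=> e f; elim: n => //= n IH; rewrite !power_wordS written_cat.
by rewrite (origin_congr y k (s_act (s_power_word n e))) f IH
  (written_congr y k (s_act (s_power_word n e))).
Qed.

(** Either the lengths drift apart at each turn, or the contents have already diverged and every
    letter written afterwards adds to the distance. *)
Lemma dist_power_word y z g h : g \in act z -> h \in act z ->
  s (y ++ z) = s z -> origin y z g = g -> origin y z h = h ->
  size (written y z g) <> size (written y z h) \/
  [/\ (delta (rval g z) (rval h z)).1 != [::],
      (delta (rval g z) (rval h z)).2 != [::] &
      0 < size (written y z g) + size (written y z h)] ->
  forall n, n <= dist (rval g (power_word y n ++ z)) (rval h (power_word y n ++ z))
                 + size (rval g z) + size (rval h z).
Proof.
move=> ga ha e fg fh H n.
have e' := s_act (s_power_word n e).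
rewrite !rval_cat ?e' // !origin_power_word // !written_power_word //.
case: H => [ne|[n1 n2 pos]].
  set X := power_word _ n ++ _; set Y := power_word _ n ++ _.
  have sX : size X = n * size (written y z g) + size (rval g z).
    by rewrite size_cat size_power_word.
  have sY : size Y = n * size (written y z h) + size (rval h z).
    by rewrite size_cat size_power_word.
  have := dist_size X Y; have := dist_size_sym X Y; rewrite sX sY.
  move: (dist X Y) => D h1 h2.
  have [lt|lt|//] := ltngtP (size (written y z g)) (size (written y z h)).
    by have := leq_mul (leqnn n) lt; rewrite mulnS; lia.
  by have := leq_mul (leqnn n) lt; rewrite mulnS; lia.
by rewrite dist_stuck // !size_power_word; have := leq_mul (leqnn n) pos;
  rewrite muln1 mulnDr; lia.
Qed.

(** One [max_label] per vertex bounds the difference of the lengths, two more the letters written on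
    both registers after they diverged. *)
Definition pump_const M := M + 3 * max_label * #|{: F * reg m * reg m}|.

(** Both registers are traced back through [e]. If no repeated triple of a state and two registers
    changed the difference of lengths, or the distance of diverged contents, [potential_bound] would
    keep the distance within [pump_const M]. So some factor of [e] is a loop worth iterating. *)
Lemma pump x e g h M : g \in act (e ++ x) -> h \in act (e ++ x) ->
  dist (rval (origin e x g) x) (rval (origin e x h) x) <= M ->
  pump_const M < dist (rval g (e ++ x)) (rval h (e ++ x)) ->
  exists (w : nat -> seq Sigma) C, forall n,
    [/\ s (w n ++ x) = s (e ++ x), origin (w n) x g = origin e x g,
        origin (w n) x h = origin e x h, size (w n) <= C + C * n &
        n <= dist (rval g (w n ++ x)) (rval h (w n ++ x)) + C].
Proof.
move=> ga ha d0 dN.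
(* [E i] consists of the [i] letters of [e] that are read first; [q k i] is the register from which
   [k] descends at that moment. *)
pose N := size e; pose E i := drop (N - i) e; pose P i := take (N - i) e.
have PE i : e = P i ++ E i by rewrite cat_take_drop.
pose q k i := origin (P i) (E i ++ x) k; pose X k i := rval (q k i) (E i ++ x).
have q_act k i : k \in act (e ++ x) -> q k i \in act (E i ++ x).
  by rewrite {1}(PE i) -catA; apply: origin_act.
pose V i := (s (E i ++ x), q g i, q h i).
have mid i k : i <= k <= N -> exists y, [/\ E k = y ++ E i, size y = k - i &
    forall r, q r i = origin y (E i ++ x) (q r k)].
  move=> /andP[ik kN]; exists (take (k - i) (E k)).
  have eE : E k = take (k - i) (E k) ++ E i.
    rewrite -{1}(cat_take_drop (k - i) (E k)); congr (_ ++ _).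
    by rewrite /E drop_drop; congr drop; lia.
  split=> //; first by rewrite size_takel // /E size_drop -/N; lia.
  move=> r; rewrite /q.
  have eP : P i = P k ++ take (k - i) (E k).
    have := PE i; rewrite {1}(PE k) {1}eE catA => /eqP.
    rewrite eqseq_cat; first by case/andP=> /eqP-> _.
    by rewrite size_cat /P !size_take_min /E size_drop -/N; lia.
  by rewrite eP origin_cat catA -eE.
have X_mid i k y r : r \in act (e ++ x) -> E k = y ++ E i ->
    (q r i = origin y (E i ++ x) (q r k)) ->
    X r k = written y (E i ++ x) (q r k) ++ X r i.
  move=> ra eE eq; have eEx : E k ++ x = y ++ (E i ++ x) by rewrite eE catA.
  by rewrite /X eEx rval_cat -?eq // -eEx; apply: q_act.
have X_step i r : r \in act (e ++ x) -> i < N ->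
    exists2 c, size c <= max_label & X r i.+1 = c ++ X r i.
  move=> ra iN; have [|y [eE sy eq]] := mid i i.+1; first by rewrite leqnSn.
  exists (written y (E i ++ x) (q r i.+1)); last exact: X_mid.
  by apply: leq_trans (size_written _ _ _) _; rewrite sy subSnn muln1.
have E0 : E 0 = [::] by rewrite /E subn0 drop_size.
have P0 : P 0 = e by rewrite /P subn0 take_size.
have EN : E N = e by rewrite /E subnn drop0.
have PN : P N = [::] by rewrite /P subnn take0.
have X0 r : X r 0 = rval (origin e x r) x by rewrite /X /q E0 P0.
have XN r : X r N = rval r (e ++ x) by rewrite /X /q EN PN.
pose ld i := (size (X g i) - size (X h i)) + (size (X h i) - size (X g i)).
pose stuck i := ((delta (X g i) (X h i)).1 != [::]) &&
                ((delta (X g i) (X h i)).2 != [::]).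
suff [i [k [ik Vik H]]] : exists i k, [/\ i < k <= N, V i = V k &
    ld i <> ld k \/ stuck i /\ dist (X g i) (X h i) <> dist (X g k) (X h k)].
  have [|y [eE sy eq]] := mid i k; first by case/andP: ik => /ltnW-> ->.
  case: Vik => es eg eh; set z := E i ++ x.
  have loop : s (y ++ z) = s z by rewrite /z catA -eE es.
  have fg : origin y z (q g i) = q g i by rewrite {1}eg -eq.
  have fh : origin y z (q h i) = q h i by rewrite {1}eh -eq.
  have Xg := X_mid i k y g ga eE (eq g); have Xh := X_mid i k y h ha eE (eq h).
  rewrite -/z -eg in Xg; rewrite -/z -eh in Xh.
  pose w n := P k ++ power_word y n ++ E i.
  pose C := size (X g i) + size (X h i) + 2 * (max_label * size (P k)) + size e.
  have D := dist_power_word (q_act g i ga) (q_act h i ha) loop fg fh.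
  have ez n : s (power_word y n ++ z) = s (E k ++ x).
    by rewrite s_power_word // -es.
  have az n := s_act (ez n); exists w, C => n.
  have ew r : r \in act (e ++ x) -> origin y z (q r i) = q r i -> q r i = q r k ->
     origin (w n) x r = origin e x r /\ origin (P k) (power_word y n ++ z) r = q r i.
    move=> ra fr er; have eP : origin (P k) (power_word y n ++ z) r = q r i.
      by rewrite (origin_congr _ _ (az n)) er.
    split=> //; rewrite /w origin_cat origin_cat -catA -/z eP origin_power_word //.
    by rewrite [in RHS](PE i) origin_cat.
  have [wg pg] := ew g ga fg eg; have [wh ph] := ew h ha fh eh.
  have sw : s (w n ++ x) = s (e ++ x).
    by rewrite /w [in RHS](PE k) -!catA -/z; apply: (cat_congr s_cons); apply: ez.
  split=> //.
    have := congr1 size (PE k).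
    by rewrite /w eE !size_cat size_power_word /C sy; nia.
  have cond : size (written y z (q g i)) <> size (written y z (q h i)) \/
      [/\ (delta (X g i) (X h i)).1 != [::], (delta (X g i) (X h i)).2 != [::] &
          0 < size (written y z (q g i)) + size (written y z (q h i))].
    case: H => [ne|[/andP[n1 n2] ne]].
      by left=> es'; apply: ne; rewrite /ld Xg Xh !size_cat es'; lia.
    by right; split=> //; move: ne; rewrite Xg Xh dist_stuck //; lia.
  have eqw r : w n ++ r = P k ++ (power_word y n ++ (E i ++ r)).
    by rewrite /w -!catA.
  have aw : act (P k ++ (power_word y n ++ z)) = act (e ++ x).
    by rewrite -(s_act sw) eqw.
  rewrite eqw !(rval_cat (u := P k)) ?aw // ?pg ?ph //.
  have := D cond n; have := dist_cat_ge (written (P k) (power_word y n ++ z) g)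
    (written (P k) (power_word y n ++ z) h) (rval (q g i) (power_word y n ++ z))
    (rval (q h i) (power_word y n ++ z)).
  have := size_written (P k) (power_word y n ++ z) g.
  have := size_written (P k) (power_word y n ++ z) h.
  by rewrite /C -/z -/(X g i) -/(X h i); lia.
apply: contrapT => noP.
have nop i k : i < k <= N -> V i = V k -> ld i = ld k /\
    (stuck i -> dist (X g i) (X h i) = dist (X g k) (X h k)).
  move=> ik Vik; split.
    by apply: contrapT => ne; apply: noP; exists i, k; split=> //; left.
  by move=> st; apply: contrapT => ne; apply: noP; exists i, k; split=> //; right.
have dld i : ld i <= dist (X g i) (X h i).
  have := dist_size (X g i) (X h i); have := dist_size_sym (X g i) (X h i).
  by rewrite /ld; lia.
pose c := #|{: F * reg m * reg m}|.
(* No loop changes the difference of the lengths, so it stays small; a large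
   distance is then due to letters written after the registers diverged. *)
have ldM i : i <= N -> ld i <= M + max_label * c.
  apply: (potential_bound (v := V) (b := predT)) => //.
  - by apply: leq_trans (dld 0) _; rewrite !X0.
  - move=> j jN; have [a sa eg] := X_step j g ga jN.
    by have [b sb eh] := X_step j h ha jN; rewrite /ld eg eh !size_cat; lia.
  - by move=> j k jk _ _ Vjk; case: (nop j k jk Vjk).
have : dist (X g N) (X h N) <= M + max_label * c + (2 * max_label) * c.
  apply: (potential_bound (v := V) (b := stuck) (d := fun i => dist (X g i) (X h i))
    _ _ _ _ (leqnn N)) => //.
  - by rewrite !X0; lia.
  - move=> j jN; have [a sa ->] := X_step j g ga jN.
    have [b sb ->] := X_step j h ha jN.
    by have := dist_cat_le a b (X g j) (X h j); lia.
  - by move=> j jN /dist_nstuck ->; apply: ldM.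
  - by move=> j k jk sj sk Vjk; case: (nop j k jk Vjk) => _; apply.
by move: dN; rewrite !XN /pump_const -/c; nia.
Qed.

End Pump.
End Runs.

(** Since the rank of [e] is minimal, [e \o u] permutes the image of [e], and some power of it is
    the identity there. *)
Lemma min_rank (T : finType) (P : (T -> T) -> Prop) f0 : P f0 ->
  (forall f g, P f -> P g -> P (f \o g)) ->
  exists2 e, P e & forall u, P u ->
    exists2 k, 0 < k & forall r, e (iter k (u \o e) r) = e r.
Proof.
move=> Pf0 Pcomp; pose rank (f : T -> T) := #|f @: T|.
have exP : exists n, `[< exists2 f, P f & rank f = n >].
  by exists (rank f0); apply/asboolP; exists f0.
case: (ex_minnP exP) => n /asboolP [e Pe re] min; exists e => // u Pu.
pose q := e \o u; pose I := e @: T.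
have qI : q @: I \subset I.
  by apply/subsetP=> _ /imsetP[r _ ->]; apply/imsetP; exists (u r).
have cqI : #|q @: I| = #|I|.
  apply/eqP; rewrite eqn_leq subset_leq_card //= -/(rank e) re.
  have -> : q @: I = (q \o e) @: T by rewrite -[RHS]/((q \o e) @: T) (imset_comp q e).
  apply: min; apply/asboolP; exists (q \o e) => //.
  exact: Pcomp (Pcomp _ _ Pe Pu) Pe.
have q_inj : {in I &, injective q} by apply/imset_injP; rewrite cqI.
have qi_I i r : r \in I -> iter i q r \in I.
  by move=> rI; elim: i => //= i IH; apply: (subsetP qI); apply: imset_f.
have qi_inj i : {in I &, injective (iter i q)}.
  elim: i => //= i IH r r' rI r'I /q_inj H; apply: IH => //.
  by apply: H; apply: qi_I.
(* Two powers of [q] coincide, as there are finitely many maps; injectivity on [I] cancels the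
   smaller exponent. *)
have [i [j [lt_ij fij]]] :
    exists i j : nat, i < j /\ forall r, iter i q r = iter j q r.
  pose f (i : 'I_(#|{ffun T -> T}|).+1) := [ffun r => iter i q r].
  have /injectivePn [i [j ij fij]] : ~~ injectiveb f.
    by apply/injectiveP=> /leq_card; rewrite card_ord ltnn.
  have fE r : iter i q r = iter j q r by move/ffunP: fij => /(_ r); rewrite !ffunE.
  have [lt|lt|/val_inj e'] := ltngtP i j; last by rewrite e' eqxx in ij.
    by exists i, j.
  by exists j, i; split=> // r; rewrite fE.
exists (j - i); first by rewrite subn_gt0.
have qk r : r \in I -> iter (j - i) q r = r.
  move=> rI; apply: (qi_inj i); rewrite ?qi_I //.
  by rewrite -(iterD i (j - i)) (subnKC (ltnW lt_ij)) fij.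
move=> r; rewrite -[RHS]qk ?imset_f //.
by elim: (j - i) => //= k <-.
Qed.

(** * Tracking differences of registers *)

Section Track.
Variables (Sigma Omega : finType) (t : seq Sigma -> option (seq Omega)).
Variable m : machine t.
Implicit Types (u v x y z : seq Sigma) (g h : reg m).
Local Notation act := (act m).
Local Notation rval := (@rval _ _ _ m).

(** The output register, its origin and the word written depend on [x] only through [act x], so one
    choice serves all such [y]. *)
Lemma t_read u x : t (u ++ x) <> None ->
  exists k, [/\ k \in act (u ++ x), t (u ++ x) = Some (rval k (u ++ x)) &
    forall y, act y = act x ->
      origin u x k \in act y /\
      t (u ++ y) = Some (written u x k ++ rval (origin u x k) y)].
Proof.
move=> tN; have := outP m (u ++ x).
case eo : (out _) => [k|] // [kA ek]; exists k; split=> // y e.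
have e' := act_cat u e; split; first by rewrite e; apply: origin_act.
have := outP m (u ++ y); rewrite e' eo -e' => -[kA' ->].
by rewrite rval_cat // (origin_congr u k e) (written_congr u k e).
Qed.

Lemma act_dom x y : act x = act y -> t x <> None -> t y <> None.
Proof.
by move=> e; have := outP m x; have := outP m y; rewrite e;
  case: (out _) => [k [_ ->]|_ ->].
Qed.

Lemma in_star_ind (P : seq Sigma -> Prop) u v : P [::] ->
  (forall w, P w -> P (u ++ w)) -> (forall w, P w -> P (v ++ w)) ->
  forall w, in_star2 u v w -> P w.
Proof.
by move=> P0 Pu Pv w [s ->]; elim: s => //= -[] s IH; [apply: Pu | apply: Pv].
Qed.

Lemma in_pow_star u v n w : in_pow_le u v n w -> in_star2 u v w.
Proof. by case=> s [_ ->]; exists s. Qed.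

Lemma size_in_pow u v n w : in_pow_le u v n w -> size w <= n * (size u + size v).
Proof.
case=> s [sn ->]; apply: (@leq_trans (size s * (size u + size v))); last first.
  by rewrite leq_mul2r sn orbT.
by elim: s {sn} => //= b s IH; rewrite size_cat mulSn leq_add //; case: b; lia.
Qed.

(** Definedness depends only on the control state, which the loops preserve; suffix-closedness then
    passes from [u] and [v] to [a] and [b]. *)
Lemma mk_fooling x a b u v (zs : nat -> seq Sigma) c :
  suffix_closed (dom t) ->
  t x <> None -> size a = size b -> suffix a u -> suffix b v ->
  act (u ++ x) = act x -> act (v ++ x) = act x ->
  (forall n, act (zs n) = act x) -> (forall n, 0 < n -> size (zs n) <= c * n) ->
  (forall n w, in_pow_le u v n w -> t (a ++ w ++ zs n) <> t (b ++ w ++ zs n)) ->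
  contains_linear_fooling_set t (dom t).
Proof.
move=> sc tx sab au bv ux vx az sz H.
pose Z z := exists n, z = zs n; exists a, b, u, v, Z.
have star w z : in_star2 u v w -> Z z -> act (w ++ z) = act x.
  move=> ws [n ->]; elim/in_star_ind: ws => [|w' IH|w' IH]; first exact: az.
    by rewrite -catA (act_cat _ IH).
  by rewrite -catA (act_cat _ IH).
have D w z : in_star2 u v w -> Z z ->
    dom t (a ++ w ++ z) /\ dom t (b ++ w ++ z).
  move=> ws Zz; have e := star w z ws Zz.
  have du : t (u ++ w ++ z) <> None.
    by apply: (act_dom (x := x)) => //; rewrite (act_cat u e) ux.
  have dv : t (v ++ w ++ z) <> None.
    by apply: (act_dom (x := x)) => //; rewrite (act_cat v e) vx.
  split.
    by move: du; have /suffixP[u' ->] := au; rewrite -catA; apply: sc.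
  by move: dv; have /suffixP[v' ->] := bv; rewrite -catA; apply: sc.
split; last first.
  move=> _ [p [w [z [[->|->] [ws [Zz ->]]]]]].
    exact: (D w z ws Zz).1.
  exact: (D w z ws Zz).2.
(* The threshold is 1, since at [n = 0] the size bound would force [zs 0] to be empty. *)
split=> //; exists c, 1 => n; exists (zs n); split; first by exists n.
by split; [exact: sz | exact: H].
Qed.

(** Bounded sequences keep the remembered differences in a finite type. *)
Definition cap B (d : seq Omega * seq Omega) :
    option (B.-bseq Omega * B.-bseq Omega) :=
  if insub d.1 is Some a then
    if insub d.2 is Some b then Some (a, b) else None
  else None.

Lemma cap_some B d c : cap B d = Some c -> d = (bseqval c.1, bseqval c.2).
Proof.
case: d => d1 d2; rewrite /cap; case: insubP => //= a _ ea.
by case: insubP => //= b _ eb [<-] /=; rewrite -ea -eb.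
Qed.

Lemma cap_none B d : cap B d = None -> B < size d.1 + size d.2.
Proof.
rewrite /cap; case: insubP => [a _ _|]; last by lia.
by case: insubP => // ; lia.
Qed.

(* A difference that exceeds [B] is given up for good: [None] is passed on to the
   registers copied from the pair, however close these are. *)
Fixpoint track B x :
    {ffun reg m * reg m -> option (B.-bseq Omega * B.-bseq Omega)} :=
  if x is a :: x' then
    [ffun p =>
      if track B x' (src (act x') a p.1, src (act x') a p.2) is Some d then
        cap B (strip (bseqval d.1 ++ rev (label (act x') a p.1))
                     (bseqval d.2 ++ rev (label (act x') a p.2)))
      else None]
  else [ffun p => cap B (delta (rval p.1 [::]) (rval p.2 [::]))].

Lemma track_some B x g h d : g \in act x -> h \in act x ->
  track B x (g, h) = Some d ->
  delta (rval g x) (rval h x) = (bseqval d.1, bseqval d.2).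
Proof.
elim: x g h d => [|a x IH] g h d ga ha /=; rewrite ffunE /=; first exact: cap_some.
case e: (track _ _ _) => [c|] // /cap_some <-.
by rewrite !rval_cons // delta_cat (IH _ _ c) //; apply: src_act.
Qed.

(** Tracking is given up at a definite step inside [e], and right after this step the contents
    differ by more than [B]. *)
Lemma track_cross B e x g h : g \in act (e ++ x) -> h \in act (e ++ x) ->
  track B x (origin e x g, origin e x h) <> None -> track B (e ++ x) (g, h) = None ->
  exists e1 e2, e = e1 ++ e2 /\
    B < dist (rval (origin e1 (e2 ++ x) g) (e2 ++ x))
             (rval (origin e1 (e2 ++ x) h) (e2 ++ x)).
Proof.
elim: e g h => [|a e IH] g h //= ga ha tN; rewrite ffunE /=.
case et: (track _ _ _) => [d|] eN.
  exists [::], (a :: e); split=> //=.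
  rewrite /dist !rval_cons // delta_cat (track_some _ _ et) ?src_act //.
  exact: cap_none eN.
have [e1 [e2 [-> H]]] := IH _ _ (src_act ga) (src_act ha) tN et.
by exists (a :: e1), e2; rewrite /= catA.
Qed.

Lemma track_small B x g h : g \in act x -> h \in act x ->
  (forall u y, x = u ++ y ->
     dist (rval (origin u y g) y) (rval (origin u y h) y) <= B) ->
  track B x (g, h) <> None.
Proof.
rewrite -(cats0 x) => ga ha H trN.
have [|e1 [e2 [e]]] := track_cross ga ha _ trN.
  rewrite /= ffunE /= => /cap_none.
  by have := H x [::] (erefl _); rewrite /dist; lia.
by rewrite cats0 ltnNge H // e cats0.
Qed.

Definition tstate B x := (act x, track B x).

Lemma tstate_cons B a x y :
  tstate B x = tstate B y -> tstate B (a :: x) = tstate B (a :: y).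
Proof.
case=> ea et; congr (_, _); first exact: act_cons.
by apply/ffunP=> p; rewrite /= !ffunE ea et.
Qed.

Lemma tstate_cat B u x y : tstate B x = tstate B y ->
  tstate B (u ++ x) = tstate B (u ++ y).
Proof. exact: cat_congr (@tstate_cons B) _ _ _. Qed.

Lemma tstate_act B x y : tstate B x = tstate B y -> act x = act y.
Proof. by case. Qed.

(** Two bounds are remembered at once: the loops to be pumped are those of [tstate B0], and the
    number of its states determines the larger bound. *)
Definition tstate2 B0 B x := (tstate B0 x, track B x).

Lemma tstate2_cons B0 B a x y :
  tstate2 B0 B x = tstate2 B0 B y -> tstate2 B0 B (a :: x) = tstate2 B0 B (a :: y).
Proof.
move=> [ea et0 et].
have [e1 e2] := tstate_cons a (congr2 pair ea et0 : tstate B0 x = tstate B0 y).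
have [_ e3] := tstate_cons a (congr2 pair ea et : tstate B x = tstate B y).
by congr (_, _, _).
Qed.

Lemma tstate2_act B0 B x y : tstate2 B0 B x = tstate2 B0 B y -> act x = act y.
Proof. by case. Qed.

Definition bounded_pair (R : {set reg m}) g h := exists b, forall x, act x = R ->
  g \in R -> h \in R -> dist (rval g x) (rval h x) <= b.

Lemma bounded_pair_origin u x g h : g \in act (u ++ x) -> h \in act (u ++ x) ->
  bounded_pair (act (u ++ x)) g h ->
  bounded_pair (act x) (origin u x g) (origin u x h).
Proof.
move=> ga ha [b Hb]; exists (b + 2 * (max_label m * size u)) => y e _ _.
have := Hb (u ++ y) (act_cat u e) ga ha.
rewrite !rval_cat ?(act_cat u e) //.
rewrite (origin_congr u g e) (origin_congr u h e).
have := dist_cat_ge (written u y g) (written u y h)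
  (rval (origin u x g) y) (rval (origin u x h) y).
by have := size_written u y g; have := size_written u y h; lia.
Qed.

Lemma bounded_pair_bound : exists B0, forall x g h, bounded_pair (act x) g h ->
  g \in act x -> h \in act x -> dist (rval g x) (rval h x) <= B0.
Proof.
have /choice [b Hb] : forall p : {set reg m} * reg m * reg m, exists b,
    bounded_pair p.1.1 p.1.2 p.2 -> forall x, act x = p.1.1 -> p.1.2 \in p.1.1 ->
    p.2 \in p.1.1 -> dist (rval p.1.2 x) (rval p.2 x) <= b.
  move=> [[R g] h] /=; have [[b Hb]|nb] := pselect (bounded_pair R g h).
    by exists b.
  by exists 0.
exists (\max_p b p) => x g h bp ga ha.
apply: leq_trans (Hb (act x, g, h) bp x erefl ga ha) _.
exact: (leq_bigmax (act x, g, h)).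
Qed.

End Track.

(** * Fooling schemes from loops *)

Section Indistinct.
Variables (Sigma Omega : finType) (t : seq Sigma -> option (seq Omega)).
Variable m : machine t.
Implicit Types (u v x y z : seq Sigma) (g h : reg m).
Local Notation act := (act m).
Local Notation rval := (@rval _ _ _ m).
Local Notation track := (track m).
Local Notation tstate := (tstate m).
Hypothesis sc : suffix_closed (dom t).

Variable B0 : nat.
Hypothesis B0P : forall x g h, bounded_pair (act x) g h ->
  g \in act x -> h \in act x -> dist (rval g x) (rval h x) <= B0.

(* Pairs tracked up to [B0] include all bounded pairs.  A difference of more than
   [track_bound] that arises from such a pair comes from a loop of the automaton
   [tstate B0] that can be pumped. *)
Definition track_bound := pump_const m {: {set reg m} * {ffun reg m * reg m ->
   option (B0.-bseq Omega * B0.-bseq Omega)}} B0.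
Local Notation s := (tstate2 m B0 track_bound).

Lemma s_loop_cat u x y : s x = s y -> s (u ++ x) = s (u ++ y).
Proof. exact: cat_congr (@tstate2_cons _ _ _ m B0 track_bound) _ _ _. Qed.

Lemma bounded_pair_track B x g h : B0 <= B -> bounded_pair (act x) g h ->
  g \in act x -> h \in act x -> track B x (g, h) <> None.
Proof.
move=> le bp ga ha; apply: track_small => // u y e; subst x.
by apply: leq_trans le; apply: B0P (bounded_pair_origin ga ha bp) _ _; apply: origin_act.
Qed.

Section Case.
Variables (x a b u v : seq Sigma) (ka kb : reg m).
Local Notation g := (origin a x ka).
Local Notation h := (origin b x kb).
Hypothesis xN : t x <> None.
Hypothesis sab : size a = size b.
Hypothesis au : suffix a u.
Hypothesis bv : suffix b v.
Hypothesis lu : s (u ++ x) = s x.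
Hypothesis lv : s (v ++ x) = s x.
Hypothesis ra : forall y, act y = act x ->
  g \in act y /\ t (a ++ y) = Some (written a x ka ++ rval g y).
Hypothesis rb : forall y, act y = act x ->
  h \in act y /\ t (b ++ y) = Some (written b x kb ++ rval h y).
Hypothesis ne : t (a ++ x) <> t (b ++ x).

Lemma far_outputs_differ y : act y = act x ->
  size (written a x ka) + size (written b x kb) < dist (rval g y) (rval h y) ->
  t (a ++ y) <> t (b ++ y).
Proof.
move=> e lt; have [_ ->] := ra e; have [_ ->] := rb e => -[/dist_cat_eq].
by rewrite leqNgt lt.
Qed.

(** Words over [u] and [v] keep the tracked difference, and this difference together with [a] and
    [b] decides whether the outputs agree. *)
Lemma fooling_tracked d : track track_bound x (g, h) = Some d ->
  contains_linear_fooling_set t (dom t).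
Proof.
move=> trd; apply: (mk_fooling (m := m) (x := x) (u := u) (v := v)
  (zs := fun=> x) (c := size x) sc xN sab au bv) => //.
- exact: tstate2_act lu.
- exact: tstate2_act lv.
- by move=> n n0; rewrite -{1}(muln1 (size x)) leq_mul2l n0 orbT.
move=> n w /in_pow_star ws.
have sw : s (w ++ x) = s x.
  elim/in_star_ind: ws => // w' IH; rewrite -catA.
    by rewrite (s_loop_cat _ IH).
  by rewrite (s_loop_cat _ IH).
have aw := tstate2_act sw.
have trw : track track_bound (w ++ x) (g, h) = Some d by case: sw => _ _ ->.
have [ga ->] := ra aw; have [ha ->] := rb aw => -[E].
apply: ne; have [gx ->] := ra erefl; have [hx ->] := rb erefl; congr Some.
apply: delta_inj; rewrite delta_cat (track_some gx hx trd) -(track_some ga ha trw).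
by rewrite -delta_cat E /delta strip_id.
Qed.

(** Within [e] the pair passes from tracked to given up, so [track_cross] finds a place to pump. The
    pumped loop [ez] preserves only [tstate B0], but this still tracks the bounded pair from which
    [ez] copies. *)
Lemma fooling_bounded e : s (e ++ x) = s x ->
  track track_bound x (g, h) = None ->
  bounded_pair (act x) (origin e x g) (origin e x h) ->
  contains_linear_fooling_set t (dom t).
Proof.
move=> le trN bp.
have ae := tstate2_act le.
have ga : g \in act (e ++ x) by case: (ra ae).
have ha : h \in act (e ++ x) by case: (rb ae).
have pa := origin_act ga; have qa := origin_act ha.
have B01 : B0 <= track_bound by apply: leq_addr.
have tr1 := bounded_pair_track B01 bp pa qa.
have trN' : track track_bound (e ++ x) (g, h) = None by case: le => _ _ ->.
have [e1 [e2 [ee lt]]] := track_cross ga ha tr1 trN'; subst e.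
rewrite -catA in ga ha ae.
have ga2 := origin_act ga; have ha2 := origin_act ha.
have fwE k : origin e2 x (origin e1 (e2 ++ x) k) = origin (e1 ++ e2) x k by rewrite origin_cat.
have [|w [C wP]] := pump (s := tstate B0) (@tstate_cons _ _ _ _ _)
  (@tstate_act _ _ _ _ _) ga2 ha2 _ lt.
  by rewrite !fwE; apply: B0P.
(* Pays for the constant of [pump], for what [e1] writes on both registers and for the words written
   by [a] and [b]. *)
pose n0 := C + 2 * (max_label m * size e1) + size (written a x ka) +
  size (written b x kb) + 1.
have [sw wg wh _ wd] := wP n0; pose ez := e1 ++ w n0.
have s_st z z' : s z = s z' -> tstate B0 z = tstate B0 z' by case=> ? ? _; congr (_, _).
have sez : tstate B0 (ez ++ x) = tstate B0 x.
  rewrite -(s_st _ _ le) /ez -!catA.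
  exact: tstate_cat.
have aez := tstate_act sez.
have sez' z : tstate B0 z = tstate B0 x -> tstate B0 (ez ++ z) = tstate B0 x.
  by move=> ez'; rewrite -sez; apply: tstate_cat.
have fg : origin ez x g = origin (e1 ++ e2) x g.
  by rewrite /ez [LHS]origin_cat (origin_congr e1 g (tstate_act sw)) wg fwE.
have fh : origin ez x h = origin (e1 ++ e2) x h.
  by rewrite /ez [LHS]origin_cat (origin_congr e1 h (tstate_act sw)) wh fwE.
have gz z : act z = act x -> g \in act z by move=> ?; case: (@ra z).
have hz z : act z = act x -> h \in act z by move=> ?; case: (@rb z).
have bp0 := bounded_pair_track (leqnn B0) bp pa qa.
(* The difference before [ez] is tracked, hence the same at [z] and at [x], and [ez] writes the same
   words over both; so the estimate at [x] suffices. *)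
have dez z : tstate B0 z = tstate B0 x ->
    size (written a x ka) + size (written b x kb) <
    dist (rval g (ez ++ z)) (rval h (ez ++ z)).
  move=> stz; have az := tstate_act stz; have az' := tstate_act (sez' z stz).
  case trd : (track B0 x (origin (e1 ++ e2) x g, origin (e1 ++ e2) x h)) => [d|] //.
  have trz : track B0 z (origin (e1 ++ e2) x g, origin (e1 ++ e2) x h) = Some d.
    by case: stz => _ ->.
  have -> : dist (rval g (ez ++ z)) (rval h (ez ++ z)) =
            dist (rval g (ez ++ x)) (rval h (ez ++ x)).
    rewrite !rval_cat ?gz ?hz // !(origin_congr _ _ az) !(written_congr _ _ az).
    rewrite fg fh.
    rewrite /dist !delta_cat (track_some _ _ trd) ?(track_some _ _ trz) ?az //.
  have awx : act (e1 ++ (w n0 ++ x)) = act x by rewrite catA.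
  rewrite -catA (rval_cat (u := e1)) ?gz // (rval_cat (u := e1)) ?hz //.
  rewrite !(origin_congr e1 _ (tstate_act sw)).
  have := dist_cat_ge (written e1 (w n0 ++ x) g) (written e1 (w n0 ++ x) h)
    (rval (origin e1 (e2 ++ x) g) (w n0 ++ x))
    (rval (origin e1 (e2 ++ x) h) (w n0 ++ x)).
  have := size_written e1 (w n0 ++ x) g; have := size_written e1 (w n0 ++ x) h.
  by move: wd; rewrite /n0; lia.
have lu' : act ((ez ++ u) ++ x) = act x.
  by rewrite -catA; apply: tstate_act (sez' _ _); apply: s_st.
have lv' : act ((ez ++ v) ++ x) = act x.
  by rewrite -catA; apply: tstate_act (sez' _ _); apply: s_st.
apply: (mk_fooling (m := m) (x := x) (u := ez ++ u) (v := ez ++ v)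
  (zs := fun=> ez ++ x) (c := size (ez ++ x)) sc xN sab) => //.
- by case/suffixP: au => u' ->; rewrite catA suffix_suffix.
- by case/suffixP: bv => v' ->; rewrite catA suffix_suffix.
- by move=> n n0'; rewrite -{1}(muln1 (size (ez ++ x))) leq_mul2l n0' orbT.
move=> n w' /in_pow_star ws.
(* Both blocks and the final word begin with [ez], and so does every product of them. *)
have [z stz ->] : exists2 z, tstate B0 z = tstate B0 x & w' ++ ez ++ x = ez ++ z.
  elim/in_star_ind: ws => [|w'' [z stz ez']|w'' [z stz ez']]; first by exists x.
    exists (u ++ ez ++ z); last by rewrite -ez' !catA.
    by rewrite -(s_st _ _ lu); apply: tstate_cat; apply: sez'.
  exists (v ++ ez ++ z); last by rewrite -ez' !catA.
  by rewrite -(s_st _ _ lv); apply: tstate_cat; apply: sez'.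
by apply: far_outputs_differ; [apply: tstate_act (sez' _ _) | apply: dez].
Qed.

(** Suitable powers [U], [V] of [e ++ u], [e ++ v] leave the copying map of [e] unchanged: whatever
    word over [U], [V] is put before [e], the content comes from the same unbounded pair. *)
Lemma fooling_unbounded e : s (e ++ x) = s x ->
  (forall y, s (y ++ x) = s x -> exists2 k, 0 < k &
     forall r : reg m, origin e x (iter k (origin y x \o origin e x) r) = origin e x r) ->
  ~ bounded_pair (act x) (origin e x g) (origin e x h) ->
  contains_linear_fooling_set t (dom t).
Proof.
move=> le eP nbp; have ae := tstate2_act le.
pose p := origin e x g; pose q := origin e x h.
(* The distance at the empty word, where pumping starts: all of the word [y] found below is
   available for it. *)
pose M := \max_(c : reg m * reg m) dist (rval c.1 [::]) (rval c.2 [::]).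
pose b0 := pump_const m {set reg m} M.
have [y [ay py qy lt]] : exists y, [/\ act y = act x, p \in act y, q \in act y &
    b0 < dist (rval p y) (rval q y)].
  apply: contrapT => H; apply: nbp; exists b0 => y ay py qy.
  by rewrite leqNgt; apply/negP => lt; apply: H; exists y; split; rewrite ?ay.
have [w [C wP]] : exists (w : nat -> seq Sigma) C, forall n,
    [/\ act (w n) = act x, size (w n) <= C + C * n &
        n <= dist (rval p (w n)) (rval q (w n)) + C].
  have [|||||w [C wP]] := @pump _ _ _ m _ act (@act_cons _ _ _ m) _ [::] y p q M;
    rewrite ?cats0 //; last first.
    by exists w, C => n; have [] := wP n; rewrite !cats0 ay.
  exact: (leq_bigmax (F := fun c => dist (rval c.1 [::]) (rval c.2 [::]))
            (origin y [::] p, origin y [::] q)).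
have aw n : act (w n) = act x by case: (wP n).
have wd n : n <= dist (rval p (w n)) (rval q (w n)) + C by case: (wP n).
have [ku ku0 kuP] := eP u lu; have [kv kv0 kvP] := eP v lv.
pose U := power_word (e ++ u) ku; pose V := power_word (e ++ v) kv.
have loop_pow y' k z : s (y' ++ x) = s x -> act z = act x ->
    act (power_word (e ++ y') k ++ z) = act x /\
    forall r : reg m, origin (power_word (e ++ y') k) z r =
                      iter k (origin y' x \o origin e x) r.
  move=> ly' az; have ay' := tstate2_act ly'; elim: k => // k [IH1 IH2].
  have a1 y2 z' : act z' = act x -> act (y2 ++ x) = act x -> act (y2 ++ z') = act x.
    by move=> e1 <-; apply: act_cat.
  rewrite power_wordS; split.
    by rewrite -!catA; apply: (a1) => //; apply: (a1).
  move=> r; rewrite iterSr origin_cat IH2; congr (iter k _ _).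
  rewrite origin_cat (origin_congr y' _ IH1) /=; congr (origin y' x _).
  by apply: origin_congr; apply: a1.
have star y' : in_star2 U V y' -> act (y' ++ x) = act x /\
    forall r : reg m, origin e x (origin y' x r) = origin e x r.
  elim/in_star_ind: y' / => [|y' [IH1 IH2]|y' [IH1 IH2]] //.
    rewrite -catA; have [e1 e2] := loop_pow u ku (y' ++ x) lu IH1.
    by split=> // r; rewrite origin_cat IH2 e2 kuP.
  rewrite -catA; have [e1 e2] := loop_pow v kv (y' ++ x) lv IH1.
  by split=> // r; rewrite origin_cat IH2 e2 kvP.
have suf a' u' k : 0 < k -> suffix a' u' -> suffix a' (power_word (e ++ u') k).
  case: k => // k _ /suffixP[u2 ->].
  by rewrite power_wordS comm_power_word // !catA suffix_suffix.
(* [K * n] outweighs all that [n] blocks can write on the two registers; [K'] covers the constant of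
   [pump], the loop [e] and the words [a], [b]. *)
pose K := 2 * (max_label m * (size U + size V)).
pose K' := C + 2 * (max_label m * size e) + size (written a x ka) +
  size (written b x kb) + 1.
apply: (mk_fooling (m := m) (x := x) (u := U) (v := V)
  (zs := fun n => e ++ w (K * n + K')) (c := size e + C + C * (K + K')) sc xN sab).
- exact: suf.
- exact: suf.
- exact: (loop_pow u ku x lu erefl).1.
- exact: (loop_pow v kv x lv erefl).1.
- by move=> n; rewrite (act_cat e (aw _)).
- move=> n n0; rewrite size_cat.
  have [_ sw _] := wP (K * n + K').
  by nia.
move=> n y' yw; have sy := size_in_pow yw; have [e1 e2] := star y' (in_pow_star yw).
set z := w _; have az : act z = act x by apply: aw.
have aez : act (e ++ z) = act x by rewrite (act_cat e az).
have ayz : act (y' ++ e ++ z) = act x by rewrite (act_cat y' aez).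
have fE (r : reg m) : origin (y' ++ e) z r = origin e x r.
  rewrite origin_cat (origin_congr e (origin y' (e ++ z) r) az).
  by rewrite (origin_congr y' r aez) e2.
apply: far_outputs_differ => //; rewrite catA in ayz *.
have ga : g \in act ((y' ++ e) ++ z) by case: (ra ayz).
have ha : h \in act ((y' ++ e) ++ z) by case: (rb ayz).
rewrite !rval_cat // !fE.
have := dist_cat_ge (written (y' ++ e) z g) (written (y' ++ e) z h) (rval p z) (rval q z).
have := size_written (y' ++ e) z g; have := size_written (y' ++ e) z h.
have := wd (K * n + K'); rewrite -/z size_cat.
have : max_label m * (size y' + size e) <=
       max_label m * (n * (size U + size V)) + max_label m * size e.
  by rewrite mulnDr leq_add2r leq_mul2l sy orbT.
by rewrite -/p -/q /K' /K; nia.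
Qed.

End Case.

Lemma loop_suffix_indistinct x a b u v : ~ contains_linear_fooling_set t (dom t) ->
  t x <> None -> size a = size b -> suffix a u -> suffix b v ->
  s (u ++ x) = s x -> s (v ++ x) = s x -> t (a ++ x) = t (b ++ x).
Proof.
move=> nf xN sab au bv lu lv; apply: contrapT => ne; apply: nf.
have aN : t (a ++ x) <> None.
  have : t (u ++ x) <> None by apply: act_dom xN; symmetry; apply: tstate2_act lu.
  by case/suffixP: au => u' ->; rewrite -catA; apply: sc.
have bN : t (b ++ x) <> None.
  have : t (v ++ x) <> None by apply: act_dom xN; symmetry; apply: tstate2_act lv.
  by case/suffixP: bv => v' ->; rewrite -catA; apply: sc.
have [ka [_ _ ra]] := t_read m aN; have [kb [_ _ rb]] := t_read m bN.
case trd: (track track_bound x (origin a x ka, origin b x kb)) => [d|].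
  exact: (fooling_tracked xN sab au bv lu lv ra rb ne trd).
pose P (f : reg m -> reg m) := exists2 e, s (e ++ x) = s x & f = origin e x.
have [|f f' [e le ->] [e' le' ->]|f [e le ->] eP] := @min_rank _ P (origin [::] x).
- by exists [::].
- exists (e' ++ e); first by rewrite -catA (s_loop_cat _ le).
  by apply/funext => r; rewrite origin_cat (origin_congr e' r (tstate2_act le)).
have eP' y : s (y ++ x) = s x -> exists2 k, 0 < k &
    forall r : reg m, origin e x (iter k (origin y x \o origin e x) r) = origin e x r.
  by move=> ly; apply: eP; exists y.
have [bp|nbp] := pselect (bounded_pair (act x)
  (origin e x (origin a x ka)) (origin e x (origin b x kb))).
  exact: (fooling_bounded xN sab au bv lu lv ra rb le trd bp).
exact: (fooling_unbounded xN sab au bv lu lv ra rb le eP' nbp).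
Qed.

End Indistinct.

(** * Polynomial growth *)

Lemma leq_expl a b k : a <= b -> a ^ k <= b ^ k.
Proof. by case: k => // k le; rewrite leq_exp2r. Qed.

(** Polynomially many candidates for each [n]; with [n.+1] the bound does not vanish at [n = 0]. *)
Definition polyset (T : eqType) (P : nat -> T -> Prop) :=
  exists (L : nat -> seq T) C k, forall n,
    size (L n) <= C * n.+1 ^ k /\ forall y, P n y -> y \in L n.

Section Polyset.
Variables T U : eqType.
Implicit Types (P : nat -> T -> Prop) (Q : nat -> U -> Prop).

Lemma polyset_sub P P' : (forall n y, P' n y -> P n y) -> polyset P -> polyset P'.
Proof.
by move=> sub [L [C [k H]]]; exists L, C, k => n; have [le HL] := H n;
  split=> // y /sub; apply: HL.
Qed.

Lemma polyset_pair P Q : polyset P -> polyset Q ->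
  polyset (fun n (p : T * U) => P n p.1 /\ Q n p.2).
Proof.
move=> [L [C [k H]]] [L' [C' [k' H']]].
exists (fun n => [seq (a, b) | a <- L n, b <- L' n]), (C * C'), (k + k') => n.
have [le HL] := H n; have [le' HL'] := H' n; split; last first.
  by move=> [a b] /= [/HL aL /HL' bL]; apply: allpairs_f.
by rewrite size_allpairs expnD mulnACA leq_mul.
Qed.

Lemma polyset_option P : polyset P ->
  polyset (fun n (o : option T) => if o is Some y then P n y else True).
Proof.
move=> [L [C [k H]]]; exists (fun n => None :: map some (L n)), C.+1, k => n.
have [le HL] := H n; split=> [|[y|//] /HL yL]; last first.
  by rewrite inE /= map_f.
by rewrite /= size_map mulSn -[X in X <= _]add1n leq_add // expn_gt0.
Qed.

(** A partial function given as a relation: it is enough that a value is determined by its data,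
    without computing it. *)
Lemma polyset_fun P (R : T -> U -> Prop) :
  (forall y a b, R y a -> R y b -> a = b) -> polyset P ->
  polyset (fun n a => exists2 y, P n y & R y a).
Proof.
move=> Rfun [L [C [k H]]].
have /choice [f Hf] : forall y, exists o : option U,
    forall a, R y a -> o = Some a.
  move=> y; have [[a Ra]|N] := pselect (exists a, R y a).
    by exists (Some a) => b Rb; rewrite (Rfun y a b).
  by exists None => a Ra; case: N; exists a.
exists (fun n => pmap f (L n)), C, k => n; have [le HL] := H n; split.
  by apply: leq_trans le; rewrite size_pmap count_size.
move=> a [y /HL yL /Hf e]; rewrite mem_pmap; apply/mapP; by exists y.
Qed.

Lemma polyset_lin P A B : polyset P -> polyset (fun n => P (A * n + B)).
Proof.
move=> [L [C [k H]]]; exists (fun n => L (A * n + B)), (C * (A + B).+1 ^ k), k => n.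
have [le HL] := H (A * n + B); split=> //; apply: leq_trans le _.
by rewrite -mulnA leq_mul2l -expnMn leq_expl ?orbT //; nia.
Qed.

Lemma polyset_seq P k : polyset P ->
  polyset (fun n (l : seq T) => size l = k /\ forall y, y \in l -> P n y).
Proof.
move=> psP; elim: k => [|k IH].
  by exists (fun=> [:: [::]]), 1, 0 => n; split=> // [[|a l]] [].
have [L [C [d H]]] := psP; have [L' [C' [d' H']]] := IH.
exists (fun n => [seq a :: b | a <- L n, b <- L' n]), (C * C'), (d + d') => n.
have [le HL] := H n; have [le' HL'] := H' n; split; last first.
  move=> [|a l] [//= [sl] Hl]; apply: allpairs_f.
    by apply/HL/Hl; rewrite inE eqxx.
  by apply: HL'; split=> // y yl; apply: Hl; rewrite inE yl orbT.
by rewrite size_allpairs expnD mulnACA leq_mul.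
Qed.

End Polyset.

Lemma polyset_fin (F : finType) : polyset (fun _ (_ : F) => True).
Proof.
by exists (fun=> enum F), #|F|, 0 => n; split=> [|y _]; rewrite ?mem_enum // -cardE muln1.
Qed.

Lemma polyset_leq : polyset (fun n i => i <= n).
Proof.
exists (fun n => iota 0 n.+1), 1, 1 => n; rewrite size_iota mul1n expn1.
by split=> // y; rewrite mem_iota.
Qed.

Definition concat_powers (A : Type) (ws : seq (seq A)) (ms : seq nat) : seq A :=
  flatten [seq power_word p.2 p.1 | p <- zip ms ws].

(** Exponents of empty words can be set to 0; any other exponent is at most the length of the
    product. *)
Lemma concat_powers_short (A : finType) (ws : seq (seq A)) ms :
  size ms = size ws -> exists ms', [/\ size ms' = size ws,
    concat_powers ws ms' = concat_powers ws ms &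
    forall i, i \in ms' -> i <= size (concat_powers ws ms)].
Proof.
elim: ws ms => [|w ws IH] [|i ms] //=; first by exists [::].
case=> /IH [ms' [sz e le]].
exists ((if nilp w then 0 else i) :: ms'); rewrite /= sz; split=> //.
  rewrite /concat_powers /= in e *; rewrite e; congr (_ ++ _).
  by case: (w) => [|//]; rewrite /power_word; elim: i.
have -> : concat_powers (w :: ws) (i :: ms) = power_word w i ++ concat_powers ws ms by [].
move=> j; rewrite inE size_cat size_power_word => /orP[/eqP->|/le]; last by lia.
by case: (w) => [|b w'] //=; nia.
Qed.

Lemma polyset_bounded (A : finType) (K : seq A -> Prop) : bounded_lang K ->
  polyset (fun n y => K y /\ size y <= n).
Proof.
case=> ws H.
apply: polyset_sub (polyset_fun (R := fun ms y => y = concat_powers ws ms) _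
   (polyset_seq (size ws) polyset_leq)); last by move=> ms a b -> ->.
move=> n y [/H [ms [sms ->]] le]; have [ms' [sz e le']] := concat_powers_short sms.
by exists ms'; rewrite ?e //; split=> // i /le' h; apply: leq_trans h le.
Qed.

Lemma suffix_expansion_cons (Sigma Omega : finType)
    (t : seq Sigma -> option (seq Omega)) a x :
  suffix_expansion t (a :: x) = odflt [::] (t (a :: x)) :: suffix_expansion t x.
Proof.
rewrite /suffix_expansion /= -[1]addn0 iotaDl -map_comp.
by congr cons; apply: eq_map => i /=; rewrite add1n.
Qed.

Lemma mem_words_le (Sigma : finType) n (x : seq Sigma) :
  (x \in words_le Sigma n) = (size x <= n).
Proof.
apply/flattenP/idP => [[_ /mapP[k + ->] /mapP[w _ ->]]|le].
  by rewrite mem_iota size_tuple.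
exists [seq val w | w <- enum {: (size x).-tuple Sigma}].
  by apply/mapP; exists (size x); rewrite ?mem_iota.
by apply/mapP; exists (in_tuple x); rewrite ?mem_enum.
Qed.

Lemma growth_leq (Sigma : finType) (Y : eqType) (f : seq Sigma -> Y)
    (X : pred (seq Sigma)) n (L : seq Y) :
  (forall x, size x <= n -> X x -> f x \in L) -> growth f X n <= size L.
Proof.
move=> H; apply: uniq_leq_size (undup_uniq _) _ => y.
rewrite mem_undup => /mapP[x]; rewrite mem_filter mem_words_le => /andP[Xx le] ->.
exact: H.
Qed.

(** * Counting suffix expansions along strongly connected components *)

Section Count.
Variables (Sigma Omega : finType) (t : seq Sigma -> option (seq Omega)).
Variable m : machine t.
Implicit Types (u v x y z : seq Sigma).
Local Notation act := (act m).
Local Notation rval := (@rval _ _ _ m).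
Local Notation E := (suffix_expansion t).
Hypothesis sc : suffix_closed (dom t).
Hypothesis bd : bounded_lang (img t).
Variables (F : finType) (s : seq Sigma -> F).
Hypothesis s_cons : forall a x y, s x = s y -> s (a :: x) = s (a :: y).
Hypothesis s_act : forall x y, s x = s y -> act x = act y.
Hypothesis s_star : forall x a b u v, t x <> None -> size a = size b ->
  suffix a u -> suffix b v -> s (u ++ x) = s x -> s (v ++ x) = s x ->
  t (a ++ x) = t (b ++ x).

(** By [preP] a content is an output in the bounded image, of linear length, with the prefix
    [prew k] removed. *)
Lemma polyset_rval : polyset (fun n w => exists (k : reg m) x,
  [/\ size x <= n, k \in act x & w = rval k x]).
Proof.
pose A := \max_(k : reg m) (size (rval k [::]) + size (prew k)).
pose R (p : reg m * seq Omega) w := w = drop (size (prew p.1)) p.2.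
apply: polyset_sub (polyset_fun (R := R) _ (polyset_pair (polyset_fin (reg m))
  (polyset_lin (2 * max_label m) (2 * A) (polyset_bounded bd)))); last first.
  by move=> p a b -> ->.
move=> n w [k [x [le kA ->]]]; exists (k, prew k ++ rval k x); last first.
  by rewrite /R /= drop_size_cat.
split=> //; split; first by exists (pre k ++ x); apply: preP.
have mA k' : size (rval k' [::]) + size (prew k') <= A by apply: leq_bigmax.
rewrite -(cats0 x) in kA *; rewrite size_cat rval_cat // size_cat.
have := size_written x [::] k; have := mA k; have := mA (origin x [::] k).
have : max_label m * size x <= max_label m * n by rewrite leq_mul2l le orbT.
rewrite /=; lia.
Qed.

(** Registers not in use are masked: the machine constrains only the contents of those in use. *)
Definition cfg y :=
  (s y, [seq (if k \in act y then Some (rval k y) else None) | k : reg m]).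

Lemma polyset_cfg : polyset (fun n c => exists2 y, size y <= n & c = cfg y).
Proof.
apply: polyset_sub (polyset_pair (polyset_fin F)
  (polyset_seq #|reg m| (polyset_option polyset_rval))).
move=> n _ [y le ->]; split=> //=; split; first by rewrite size_map -cardE.
by move=> _ /mapP[k _ ->]; case: ifP => // kA; exists k, y.
Qed.

Lemma cfg_read a y z : cfg y = cfg z -> t (a ++ y) = t (a ++ z).
Proof.
case=> /s_act eA /eq_in_map eV.
have := outP m (a ++ y); have := outP m (a ++ z); rewrite (act_cat a eA).
case: (out _) => [k|-> -> //] [ka ->] [_ ->].
have ka' : k \in act (a ++ y) by rewrite (act_cat a eA).
rewrite !rval_cat // (origin_congr a k eA) (written_congr a k eA).
have kz := origin_act ka; have := eV (origin a z k); rewrite mem_enum eA kz.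
by move/(_ isT) => -[->].
Qed.

Lemma expansion_cat w w' y z : size w = size w' -> E y = E z ->
  (forall a a', suffix a w -> suffix a' w' -> size a = size a' ->
     t (a ++ y) = t (a' ++ z)) ->
  E (w ++ y) = E (w' ++ z).
Proof.
elim: w w' => [|b w IH] [|b' w'] //= [sz] eE H.
rewrite !suffix_expansion_cons; congr cons.
  by rewrite -!cat_cons (H (b :: w) (b' :: w')) ?suffix_refl //= sz.
apply: IH => // a a' aw aw'; apply: H.
  by case/suffixP: aw => p ->; rewrite -cat_cons suffix_suffix.
by case/suffixP: aw' => p ->; rewrite -cat_cons suffix_suffix.
Qed.

(** This set can only shrink as the word grows; as long as it keeps its size, the component has not
    been left. *)
Definition reach x := [set f | `[< exists u, s (u ++ x) = f >]].

Lemma reach_cat w y : reach (w ++ y) \subset reach y.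
Proof.
apply/subsetP=> f; rewrite !inE => /asboolP[u <-]; apply/asboolP.
by exists (u ++ w); rewrite catA.
Qed.

Lemma reach_self x : s x \in reach x.
Proof. by rewrite inE; apply/asboolP; exists [::]. Qed.

Lemma reach_loop w y : #|reach (w ++ y)| = #|reach y| ->
  exists u, s ((u ++ w) ++ y) = s y.
Proof.
move=> e; have /eqP eR : reach (w ++ y) == reach y.
  by rewrite eqEcard reach_cat e leqnn.
have := reach_self y; rewrite -eR inE => /asboolP[u eu].
by exists u; rewrite -catA.
Qed.

(* [y] is the suffix of [x] at which its strongly connected component is entered. *)
Lemma reach_entry x : exists w y, [/\ x = w ++ y, #|reach x| = #|reach y| &
  y = [::] \/ exists b y', y = b :: y' /\ #|reach y| < #|reach y'|].
Proof.
elim: x => [|a x [w [y [e er H]]]]; first by exists [::], [::]; split=> //; left.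
have := subset_leq_card (reach_cat [:: a] x); rewrite leq_eqVlt => /orP[/eqP e'|lt].
  by exists (a :: w), y; split=> //; [rewrite e | rewrite -er -e'].
by exists [::], (a :: x); split=> //; right; exists a, x.
Qed.

(** Entering a new component shrinks the reachable set and uses up at least one unit of [d]. An
    expansion is determined by the length read inside the last component, the configuration at its
    entry and the expansion before it. *)
Lemma polyset_expansion d : polyset (fun n e => exists x,
  [/\ size x <= n, t x <> None, #|F| < #|reach x| + d & e = E x]).
Proof.
elim: d => [|d IH].
  exists (fun=> [::]), 0, 0 => n; split=> // e [x [_ _ + _]].
  by rewrite addn0 ltnNge max_card.
(* The last entry of [p] is [None] if the component is entered at the empty word, and otherwise the
   expansion just before the entry. *)
pose R (p : nat * ((F * seq (option (seq Omega))) * option (seq (seq Omega)))) e :=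
  exists w y, [/\ p.1 = size w, p.2.1 = cfg y, #|reach (w ++ y)| = #|reach y|,
    t (w ++ y) <> None &
    (y = [::] /\ p.2.2 = None \/
     exists b y', y = b :: y' /\ p.2.2 = Some (E y')) /\ e = E (w ++ y)].
apply: polyset_sub (polyset_fun (R := R) _ (polyset_pair polyset_leq
  (polyset_pair polyset_cfg (polyset_option IH)))); last first.
  move=> [k [c o]] e e' [w [y [/= ek ec er et [eo ->]]]].
  move=> [w' [y' [/= ek' ec' er' et' [eo' ->]]]].
  have ecc : cfg y = cfg y' by rewrite -ec.
  (* [u] and [u'] close [w] and [w'] to loops at the common entry state, as [s_star] requires. *)
  have [u eu] := reach_loop er; have [u' eu'] := reach_loop er'.
  have es : s y = s y' by case: ecc.
  have yN : t y <> None by move: et; apply: sc.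
  have eE : E y = E y'.
    case: eo => [[-> eo]|[b [y1 [ey eo]]]]; case: eo' => [[-> eo']|[b' [y1' [ey' eo']]]] //.
    - by rewrite eo in eo'.
    - by rewrite eo in eo'.
    - have := cfg_read [::] ecc; rewrite /= ey ey' !suffix_expansion_cons => ->.
      by move: eo'; rewrite eo => -[->].
  apply: expansion_cat => //; first by rewrite -ek.
  move=> a a' aw aw' sa; rewrite -(cfg_read a' ecc).
  apply: (s_star yN sa (u := u ++ w) (v := u' ++ w')) => //.
  - by case/suffixP: aw => p ->; rewrite catA suffix_suffix.
  - by case/suffixP: aw' => p ->; rewrite catA suffix_suffix.
  - by rewrite (cat_congr s_cons _ es) eu' es.
move=> n e [x [le tx lt ->]]; have [w [y [ex er H]]] := reach_entry x; subst x.
rewrite size_cat in le.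
case: H => [ey|[b [y' [ey lt']]]].
  exists (size w, (cfg y, None)); last first.
    by exists w, y; split=> //; split=> //; left.
  by split=> /=; [lia | split=> //; exists y => //; lia].
exists (size w, (cfg y, Some (E y'))); last first.
  by exists w, y; split=> //; split=> //; right; exists b, y'.
split=> /=; [lia | split; first by exists y => //; lia].
rewrite ey /= in le; exists y'; split=> //; first by lia.
  by move: tx; rewrite ey -cat1s catA; apply: sc.
by apply: leq_trans lt _; rewrite er addnS -addSn leq_add2r.
Qed.

Lemma expansion_growth :
  grows_polynomially (growth E (fun x => isSome (t x))).
Proof.
(* With [d = #|F|] the condition on [reach x] always holds, as this set contains [s x]. For positive
   [n], [n.+1 ^ k] is at most [2 ^ k * n ^ k]. *)
have [L [C [k H]]] := polyset_expansion #|F|.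
exists k, (C * 2 ^ k), 1 => n n1; have [le HL] := H n.
apply: (@leq_trans (size (L n))).
  apply: growth_leq => x sx tx; apply: HL; exists x; split=> //.
    by case: (t x) tx.
  rewrite -[X in X < _]add0n ltn_add2r card_gt0; apply/set0Pn.
  by exists (s x); apply: reach_self.
apply: leq_trans le _; rewrite -mulnA leq_mul2l -expnMn leq_expl ?orbT //; lia.
Qed.

End Count.

(** * Exponential growth *)

Lemma growth_geq_pow2 (Sigma : finType) (Y : eqType) (f : seq Sigma -> Y)
    (X : pred (seq Sigma)) n N (W : seq bool -> seq Sigma) :
  (forall b b', size b = n -> size b' = n -> f (W b) = f (W b') -> b = b') ->
  (forall b, size b = n -> size (W b) <= N /\ X (W b)) ->
  2 ^ n <= growth f X N.
Proof.
move=> inj H; pose l := [seq f (W (val b)) | b : n.-tuple bool].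
have -> : 2 ^ n = size l by rewrite size_map -cardE card_tuple card_bool.
apply: uniq_leq_size.
  rewrite map_inj_uniq ?enum_uniq // => b b' /inj e.
  by apply/val_inj/e; rewrite size_tuple.
move=> _ /mapP[b _ ->]; rewrite mem_undup map_f // mem_filter mem_words_le.
by have [-> ->] := H _ (size_tuple b).
Qed.

Lemma INR_pow2 n : INR (2 ^ n) = pow 2 n.
Proof. by elim: n => // n IH; rewrite expnS mult_INR IH. Qed.

(** The base is the [P]-th root of 2. *)
Lemma exponential_pow2 (f : nat -> nat) P : 0 < P ->
  (forall n, 0 < n -> 2 ^ n <= f (P * n)) -> grows_exponentially f.
Proof.
move=> P0 H; have P0' : Rlt (IZR 0) (INR P) by apply: lt_0_INR; apply/ltP.
exists (Rpower 2 (/ INR P)); split.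
  rewrite -(Rpower_O 2); last by lra.
  by apply: Rpower_lt; [lra | apply: Rinv_0_lt_compat].
move=> N; exists (P * N.+1); split; first by nia.
rewrite pow_mult -(Rpower_pow P); last by apply: exp_pos.
rewrite Rpower_mult Rinv_l; last by lra.
rewrite Rpower_1; last by lra.
rewrite -INR_pow2; apply: le_INR; apply/leP; exact: H.
Qed.

(** Codes are compared at their last differing bit, because expansions see only suffixes. *)
Lemma common_suffix (b b' : seq bool) : size b = size b' -> b <> b' ->
  exists c p p' a, b = p ++ a :: c /\ b' = p' ++ (~~ a) :: c.
Proof.
elim: b b' => [|a b IH] [|a' b'] //= [sb] ne.
have [e|/eqP ne'] := eqVneq b b'.
  exists b, [::], [::], a; rewrite e; split=> //; congr cons.
  by case: a a' ne => -[] //; rewrite e.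
have [c [p [p' [d [-> ->]]]]] := IH _ sb ne'.
by exists c, (a :: p), (a' :: p'), d.
Qed.

Section Expansion.
Variables (Sigma Omega : finType) (t : seq Sigma -> option (seq Omega)).
Local Notation E := (suffix_expansion t).

Lemma size_expansion x : size (E x) = size x.
Proof. by rewrite size_map size_iota. Qed.

Lemma expansion_suffix p p' y y' : E (p ++ y) = E (p' ++ y') ->
  size y = size y' -> E y = E y'.
Proof.
move=> e sy; have := congr1 size e; rewrite !size_expansion !size_cat sy.
move/addIn => sp; elim: p p' sp e => [|a p IH] [|a' p'] //= [sp].
by rewrite !suffix_expansion_cons => -[_]; apply: IH.
Qed.

(** Definedness is asked on both sides because the default of [odflt] is itself a possible
    output. *)
Lemma expansion_head x y : E x = E y -> 0 < size x -> t x <> None ->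
  t y <> None -> t x = t y.
Proof.
move=> e; have := congr1 size e; rewrite !size_expansion.
case: x y e => [|a x] [|b y] //; rewrite !suffix_expansion_cons => -[e _] _ _.
by case: (t _) e => // ?; case: (t _) => // ? /= ->.
Qed.

Hypothesis sc : suffix_closed (dom t).

(** Take all products of [n] blocks followed by one word [z]. To the right of their last differing
    block two of them agree, and the scheme separates the outputs after [u2] and [v2]. *)
Lemma fooling_exponential : contains_linear_fooling_set t (dom t) ->
  grows_exponentially (growth E (fun x => isSome (t x))).
Proof.
case=> u2 [v2 [u [v [Z [[su sv sz D [c [N H]]] _]]]]].
pose W (z : seq Sigma) s := flatten [seq if b then u else v | b <- s] ++ z.
pose w (s : seq bool) := flatten [seq if b then u else v | b <- s].
have wS s : in_star2 u v (w s) by exists s.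
pose L := size u + size v.
have sw s : size (w s) <= size s * L.
  by elim: s => //= b s IH; rewrite size_cat mulSn leq_add // /L; case: b; lia.
(* Words of equal length that give different outputs cannot be empty. *)
have [u0 v0] : 0 < size u2 /\ 0 < size v2.
  rewrite -sz; have [z [_ [_ ne]]] := H 0.
  have : t (u2 ++ [::] ++ z) <> t (v2 ++ [::] ++ z) by apply: ne; exists [::].
  by case: (u2) (v2) sz => [|a p] [|b q] // _.
apply: (@exponential_pow2 _ (L + c + c * N).+1) => // n n0.
(* The shift by [N] passes the threshold of the size bound; its cost [c * N] is part of the constant
   above. *)
have [z [Zz [sz' ne]]] := H (n + N).
have sfx a s : exists p, (if a then u else v) ++ w s ++ z =
    p ++ (if a then u2 else v2) ++ w s ++ z.
  by case: a; [case/suffixP: su => p -> | case/suffixP: sv => p ->];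
    exists p; rewrite -catA.
apply: (growth_geq_pow2 (n := n) (W := fun s => w s ++ z)); last first.
  move=> s ss; split.
    by have := sz' (leq_addl _ _); have := sw s; rewrite size_cat ss; nia.
  have [D1 _] := D (w s) z (wS s) Zz.
  by have := sc D1; rewrite /dom; case: (t _).
move=> b b' sb sb' eE; apply: contrapT => neb.
have [s [p [p' [a [eb eb']]]]] := common_suffix (etrans sb (esym sb')) neb.
have [q eq] : exists q, w b ++ z = q ++ (if a then u2 else v2) ++ w s ++ z.
  have [q eq] := sfx a s; exists (w p ++ q).
  by rewrite eb /w map_cat flatten_cat /= -!catA -/(w s) eq.
have [q' eq'] : exists q', w b' ++ z = q' ++ (if ~~ a then u2 else v2) ++ w s ++ z.
  have [q' eq'] := sfx (~~ a) s; exists (w p' ++ q').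
  by rewrite eb' /w map_cat flatten_cat /= -!catA -/(w s) eq'.
rewrite eq eq' in eE.
have {}eE : E (u2 ++ w s ++ z) = E (v2 ++ w s ++ z).
  by case: (a) eE => eE; [| symmetry]; apply: (expansion_suffix eE);
    rewrite !size_cat sz.
have [D1 D2] := D (w s) z (wS s) Zz.
apply: (ne (w s)); last by apply: expansion_head eE _ D1 D2; rewrite size_cat; lia.
exists s; split=> //; move: sb; rewrite eb size_cat /=; lia.
Qed.

(** * Words written by loops at one register *)

Variable m : machine t.
Local Notation act := (act m).
Local Notation rval := (@rval _ _ _ m).

Definition loop u y (k : reg m) :=
  [/\ k \in act y, act (u ++ y) = act y & origin u y k = k].

Lemma loop_cat u v y k : loop u y k -> loop v y k ->
  loop (u ++ v) y k /\ written (u ++ v) y k = written u y k ++ written v y k.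
Proof.
move=> [kA au fu] [_ av fv]; split.
  split=> //; first by rewrite -catA (act_cat u av).
  by rewrite origin_cat (origin_congr u k av) fu fv.
by rewrite written_cat (origin_congr u k av) (written_congr u k av) fu.
Qed.

(** [u ++ v] and [v ++ u] have the same length and write different words of the same length, so
    their products spell a binary code; [preP] makes it visible in the output. *)
Lemma noncommuting_exponential u v y k : loop u y k -> loop v y k ->
  written u y k ++ written v y k <> written v y k ++ written u y k ->
  grows_exponentially (growth E (fun x => isSome (t x))).
Proof.
move=> lu lv ne; have [lA cA] := loop_cat lu lv; have [lB cB] := loop_cat lv lu.
pose wd (s : seq bool) := flatten [seq if b then u ++ v else v ++ u | b <- s].
pose cd (s : seq bool) := flatten [seq if b then written u y k ++ written v y k
                                       else written v y k ++ written u y k | b <- s].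
have wdP s : loop (wd s) y k /\ written (wd s) y k = cd s.
  elim: s => [|b s [IH1 IH2]]; first by case: lu.
  case: b; rewrite /wd /cd /= -/(wd s) -/(cd s) -IH2 -?cA -?cB; exact: loop_cat.
have cd_inj s s' : size s = size s' -> cd s = cd s' -> s = s'.
  elim: s s' => [|b s IH] [|b' s'] //= [/IH{}IH] /eqP; rewrite /cd /=.
  rewrite eqseq_cat; last by case: (b) (b') => -[]; rewrite !size_cat // addnC.
  by case/andP=> /eqP e /eqP /IH ->; case: b b' e => -[] // e; case: ne.
have sA : size (v ++ u) = size (u ++ v) by rewrite !size_cat addnC.
have A0 : 0 < size (u ++ v).
  by rewrite lt0n size_eq0; apply/eqP=> eA; apply: ne; case: (u) (v) eA => [|? ?] [].
have swd s : size (wd s) = size s * size (u ++ v).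
  elim: s => //= b s IH; rewrite /wd /= size_cat -/(wd s) IH mulSn.
  by case: b; rewrite ?sA.
pose W s := pre k ++ wd s ++ y.
have tW s : t (W s) = Some (prew k ++ cd s ++ rval k y).
  have [[kA' aw origin'] written'] := wdP s.
  by rewrite preP ?aw // rval_cat ?aw // written' origin'.
pose P := size (pre k) + size (u ++ v) + size y.
apply: (@exponential_pow2 _ P.+1) => // n n0.
apply: (growth_geq_pow2 (n := n) (W := W)); last first.
  by move=> s ss; rewrite tW /W !size_cat swd ss /P; split=> //; nia.
move=> b b' sb sb' eE; apply: cd_inj; first by rewrite sb sb'.
have : t (W b) = t (W b').
  by apply: expansion_head eE _ _ _; rewrite ?tW // /W !size_cat swd sb; nia.
rewrite !tW => -[/(congr1 (drop (size (prew k)))) e].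
move: e; rewrite !drop_size_cat // => /(congr1 rev); rewrite !rev_cat.
by move/(congr1 (drop (size (rev (rval k y)))));
  rewrite !drop_size_cat // => /(can_inj revK).
Qed.

Definition in_powers (ws : seq (seq Omega)) y :=
  exists ms, size ms = size ws /\ y = concat_powers ws ms.

Lemma in_powers_cat ws ws' y y' : in_powers ws y -> in_powers ws' y' ->
  in_powers (ws ++ ws') (y ++ y').
Proof.
move=> [ms [sz ->]] [ms' [sz' ->]]; exists (ms ++ ms').
by rewrite !size_cat sz sz' /concat_powers zip_cat // map_cat flatten_cat.
Qed.

Lemma in_powers_nil ws : in_powers ws [::].
Proof.
elim: ws => [|w ws [ms [sz e]]]; first by exists [::].
by exists (0 :: ms); rewrite /= sz.
Qed.

Lemma in_powers_mem ws w n : w \in ws -> in_powers ws (power_word w n).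
Proof.
elim: ws => // w' ws IH; rewrite inE => /orP[/eqP->|/IH [ms [sz e]]].
  have [ms [sz e]] := in_powers_nil ws; exists (n :: ms); rewrite /= sz; split=> //.
  by rewrite /concat_powers /= -/(concat_powers ws ms) -e cats0.
by exists (0 :: ms); rewrite /= sz.
Qed.

(** The vertices met when the content of [k] is traced back to the empty word. *)
Fixpoint chain x k : seq ({set reg m} * reg m) :=
  (act x, k) :: (if x is a :: x' then chain x' (src (act x') a k) else [::]).

Lemma chain_cat w y k : {subset chain y (origin w y k) <= chain (w ++ y) k}.
Proof.
elim: w k => [|a w IH] k v //= /IH vc.
by rewrite inE vc orbT.
Qed.

(** [y] is cut at the visit to [v] nearest to the empty word, so that [v] does not recur in what
    remains. *)
Lemma chain_last x k v : v \in chain x k -> exists w y,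
  [/\ x = w ++ y, (act y, origin w y k) = v &
    y = [::] \/ exists b y', y = b :: y' /\
      v \notin chain y' (src (act y') b (origin w y k))].
Proof.
elim: x k => [|a x IH] k.
  by rewrite inE => /eqP->; exists [::], [::]; split=> //; left.
have [/IH [w [y [-> e H]]] _|vN] := boolP (v \in chain x (src (act x) a k)).
  by exists (a :: w), y.
rewrite /= inE (negPf vN) orbF => /eqP ev; rewrite ev in vN *.
by exists [::], (a :: x); split=> //; right; exists a, x.
Qed.

(** All visits to the first vertex of a chain are cut out as one loop, which writes a power of the
    root of this vertex. One label follows, and the vertex is never met again; so the number of
    vertices bounds the number of powers. *)
Lemma commuting_bounded :
  (forall u v y k, loop u y k -> loop v y k ->
     written u y k ++ written v y k = written v y k ++ written u y k) -> bounded_lang (img t).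
Proof.
move=> comm.
(* All loops at a vertex commute with one that writes a nonempty word, if there is one, and are
   powers of its root; otherwise the empty word serves. *)
have /choice [root rootP] : forall v : {set reg m} * reg m, exists w,
    forall u y, act y = v.1 -> loop u y v.2 ->
      exists n, written u y v.2 = power_word w n.
  move=> [R k] /=.
  have [[u [y [ay lu cu]]]|N] := pselect (exists u y, [/\ act y = R, loop u y k &
      written u y k != [::]]); last first.
    exists [::] => u y ay lu; exists 0; apply/eqP; apply: contrapT => /negP cN.
    by apply: N; exists u, y.
  have [w wP] := comm_root cu; exists w => v z az [kz av fv].
  have azy : act z = act y by rewrite az.
  have lv : loop v y k.
    by split; rewrite -?azy // -(act_cat v azy, origin_congr v k azy).
  by rewrite (written_congr v k azy); apply: wP; apply: comm.
pose WV := [seq root v | v : {set reg m} * reg m].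
pose LB := [seq label p.1.1 p.1.2 p.2 | p : {set reg m} * Sigma * reg m] ++
           [seq rval k [::] | k : reg m].
(* Each round lists all roots and labels; exponent 0 skips those not taken. *)
pose WS d := iter d (fun l => WV ++ LB ++ l) [::].
suff H d x k : k \in act x -> #|[set v in chain x k]| <= d ->
    in_powers (WS d) (rval k x).
  exists (WS #|{: {set reg m} * reg m}|) => y [x tx].
  have := outP m x; rewrite tx; case: (out _) => // k [kA [->]].
  by apply: H => //; apply: max_card.
elim: d x k => [|d IH] x k kA.
  rewrite leqn0 cards_eq0 => /eqP/setP/(_ (act x, k)); rewrite !inE.
  by case: (x) => [|a x'] /=; rewrite inE eqxx.
have : (act x, k) \in chain x k by case: (x) => [|a x'] /=; rewrite inE eqxx.
move=> vc; have [w [y [ex [ay fwk] H]]] := chain_last vc => le.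
have kAy : k \in act y by rewrite ay.
have lw : loop w y k by split; rewrite // ay ex.
have [n en] := rootP (act x, k) w y ay lw.
rewrite ex rval_cat -?ex // fwk [written _ _ _]en /WS iterS -/(WS d).
apply: in_powers_cat; first by apply/in_powers_mem/map_f/mem_enum.
have LBm l : l \in LB -> in_powers LB l.
  by move=> /(in_powers_mem 1); rewrite /power_word /= cats0.
case: H => [ey|[b [y' [ey vN]]]].
  rewrite ey -[rval _ _]cats0; apply: in_powers_cat (in_powers_nil _).
  by apply: LBm; rewrite mem_cat; apply/orP; right; apply/map_f/mem_enum.
rewrite ey in kAy vN fwk *; rewrite rval_cons //; apply: in_powers_cat.
  apply: LBm; rewrite mem_cat; apply/orP; left.
  by apply/mapP; exists (act y', b, k); rewrite ?mem_enum.
rewrite fwk in vN; apply: IH; first exact: src_act.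
rewrite -ltnS; apply: leq_trans le; apply: proper_card; apply/properP; split.
  apply/subsetP=> v; rewrite !inE => vc'; rewrite ex ey; apply: chain_cat.
  by rewrite fwk /= inE vc' orbT.
by exists (act x, k); rewrite inE.
Qed.

End Expansion.

(** * The machine of a transducer *)

Section TransducerMachine.
Variables (Sigma Omega : finType) (t : seq Sigma -> option (seq Omega)).
Variable T : transducer Sigma Omega.
Hypothesis TP : forall x y, tr_accepts T x y <-> t x = Some y.
Implicit Types (x : seq Sigma) (y : seq Omega).
Local Notation key0 := (seq Sigma * tr_state T)%type.
Local Notation tr_run := (@tr_run Sigma Omega T).

Lemma In_mem (A : eqType) (a : A) (l : seq A) : List.In a l -> a \in l.
Proof.
elim: l => //= b l IH [->|/IH]; rewrite inE ?eqxx // => ->.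
by rewrite orbT.
Qed.

(* The key [(u, q)] stands for a run that is inside a transition to [q] of which
   the input [u] remains to be read. *)
Definition keys : seq key0 :=
  [seq ([::], q) | q : tr_state T] ++
  flatten [seq [seq (drop i e.1.1.2, e.2) | i <- iota 0 (size e.1.1.2).+1]
          | e <- tr_delta T].

Lemma keys_state q : ([::], q) \in keys.
Proof. by rewrite mem_cat map_f ?mem_enum. Qed.

Lemma keys_behead a u q : (a :: u, q) \in keys -> (u, q) \in keys.
Proof.
rewrite !mem_cat => /orP[/mapP[q' _ [//]]|/flattenP[_ /mapP[e eT ->]]].
move=> /mapP[i]; rewrite mem_iota => /andP[_ ile] [ed eq].
apply/orP; right; apply/flattenP.
exists [seq (drop j e.1.1.2, e.2) | j <- iota 0 (size e.1.1.2).+1].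
  by apply/mapP; exists e.
have lt : i < size e.1.1.2.
  by have := congr1 size ed; rewrite size_drop /=; lia.
apply/mapP; exists i.+1; first by rewrite mem_iota; lia.
by rewrite eq -add1n -drop_drop -ed /= drop0.
Qed.

Lemma keys_delta p a u v q : List.In (p, a :: u, v, q) (tr_delta T) ->
  (u, q) \in keys.
Proof.
move=> /In_mem eT; rewrite mem_cat; apply/orP; right.
apply/flattenP.
exists [seq (drop j (a :: u), q) | j <- iota 0 (size u).+2].
  by apply/mapP; exists (p, a :: u, v, q).
by apply/mapP; exists 1; rewrite ?mem_iota //= drop0.
Qed.

Definition krun (k : key0) x y := exists x' r,
  [/\ x = k.1 ++ x', tr_run k.2 x' y r & tr_final r].

(** Such a context makes the output of [k] on each input unique, since [t] is a function. *)
Definition kacc (k : key0) z w := forall x y, krun k x y -> t (z ++ x) = Some (w ++ y).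

(** Stated through runs, so that a link may comprise several transitions with empty input. *)
Definition klink a (k k' : key0) c :=
  forall x y, krun k' x y -> krun k (a :: x) (c ++ y).

Lemma kacc_link a k k' c z w : kacc k z w -> klink a k k' c ->
  kacc k' (rcons z a) (w ++ c).
Proof. by move=> H L x y /L /H; rewrite cat_rcons -catA. Qed.

(** By induction on the run, transitions with empty input are absorbed into the link until one reads
    [a]. *)
Lemma krun_cons a (k : key0) x y : k \in keys -> krun k (a :: x) y ->
  exists k' c, [/\ k' \in keys, klink a k k' c & exists y', krun k' x y'].
Proof.
case: k => [[|b u] q] kK [x' [r [/= ex run fin]]]; last first.
  case: ex => ea ex; subst b; exists (u, q), [::]; split; first exact: keys_behead kK.
    by move=> x1 y1 [x2 [r2 [/= -> run2 fin2]]]; exists x2, r2.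
  by exists y, x', r.
elim: run ex fin {kK} => [//|p u v q1 x1 y1 r1 eT run IH] ex fin.
case: u eT ex => [|b u] eT /= ex.
  have [k' [c [kK L R]]] := IH ex fin; exists k', (v ++ c); split=> // x2 y2 /L.
  move=> [x3 [r3 [/= e3 run3 fin3]]]; exists (a :: x2), r3; split=> //.
  by rewrite -catA -[a :: x2]cat0s; apply: tr_run_cons eT _; rewrite e3.
case: ex => ea ex; subst b; exists (u, q1), v; split; first exact: keys_delta eT.
  move=> x2 y2 [x3 [r3 [/= -> run3 fin3]]]; exists ((a :: u) ++ x3), r3; split=> //.
  exact: tr_run_cons eT run3.
by exists y1, x1, r1.
Qed.

(** Registers are keys, and a content is the output of some accepting run from its key. On live keys
    this output is unique, so runs and links may be chosen arbitrarily. *)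
Lemma transducer_machine : inhabited (machine t).
Proof.
pose K : finType := seq_sub keys.
pose live (k : K) := exists z w, kacc (val k) z w.
pose active k x := live k /\ exists y, krun (val k) x y.
pose act x := [set k | `[< active k x >]].
have actP k x : reflect (active k x) (k \in act x) by rewrite inE; apply: asboolP.
have /choice [rv rvP] : forall p : K * seq Sigma, exists y,
    (exists y', krun (val p.1) p.2 y') -> krun (val p.1) p.2 y.
  move=> [k x] /=; have [[y H]|N] := pselect (exists y, krun (val k) x y).
    by exists y.
  by exists [::].
have /choice [pr prP] : forall k : K, exists p, live k -> kacc (val k) p.1 p.2.
  move=> k; have [[z [w H]]|N] := pselect (live k); first by exists (z, w).
  by exists ([::], [::]).
have krun_fun k x y y' : live k -> krun (val k) x y -> krun (val k) x y' -> y = y'.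
  move=> [z [w H]] /H e /H; rewrite e => -[e'].
  by have := congr1 (drop (size w)) e'; rewrite !drop_size_cat.
(* Links are sought within the set of active keys, so their choice depends on the control state and
   not on the word. *)
pose good (p : {set K} * Sigma * K) (r : K * seq Omega) :=
  r.1 \in p.1.1 /\ klink p.1.2 (val p.2) (val r.1) r.2.
have /choice [nx nxP] : forall p, exists r, (exists r', good p r') -> good p r.
  move=> p; have [[r H]|N] := pselect (exists r, good p r); first by exists r.
  by exists (p.2, [::]).
have stepP a x k : k \in act (a :: x) -> exists r, good (act x, a, k) r.
  move=> /actP[lk [y R]]; have [k' [c [kK L [y' R']]]] := krun_cons (valP k) R.
  exists (SeqSub kK, c); split=> //=; apply/actP; split; last by exists y'.
  by case: lk => z [w H]; exists (rcons z a), (w ++ c); apply: kacc_link H L.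
have step k a x r : live k -> good (act x, a, k) r ->
    active k (a :: x) /\ rv (k, a :: x) = r.2 ++ rv (r.1, x).
  move=> lk [/= /actP[lr [y R]] L]; have R' := L _ _ (rvP (r.1, x) (ex_intro _ y R)).
  split; first by split=> //; exists (r.2 ++ rv (r.1, x)).
  apply: (krun_fun k (a :: x)) => //; apply: (rvP (k, a :: x)).
  by exists (r.2 ++ rv (r.1, x)).
pose outk (R : {set K}) := [pick k in R | `[< (val k).1 = [::] /\ tr_init (val k).2 >]].
constructor; apply: (@Machine _ _ t K act (fun k x => rv (k, x))
  (fun R a k => (nx (R, a, k)).1) (fun R a k => (nx (R, a, k)).2) outk
  (fun k => (pr k).1) (fun k => (pr k).2)).
- move=> a x y e.
  suff sub x1 x2 : act x1 = act x2 -> act (a :: x1) \subset act (a :: x2).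
    by apply/eqP; rewrite eqEsubset !sub.
  move=> e12; apply/subsetP=> k kA; have /actP[lk _] := kA.
  have [r gr] := stepP _ _ _ kA; rewrite e12 in gr.
  by apply/actP; have [] := step _ _ _ _ lk gr.
- by move=> a x k kA; have [] := nxP _ (stepP _ _ _ kA).
- move=> a x k kA; have /actP[lk _] := kA.
  by have [_ ->] := step _ _ _ _ lk (nxP _ (stepP _ _ _ kA)).
- move=> x; rewrite /outk; case: pickP => [k /andP[kA /asboolP[k1 k2]]|N].
    split=> //; apply/TP; have /actP[_ H] := kA.
    have [x' [r [ex run fin]]] := rvP (k, x) H; rewrite k1 /= in ex.
    by rewrite -ex in run; exists (val k).2, r.
  (* If [t x] were defined, the initial state of an accepting run would be an active key, live by
     the empty context. *)
  case e: (t x) => [y|] //; have /TP [p [q [ip [fq run]]]] := e.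
  have := N (SeqSub (keys_state p)); rewrite (introT (actP _ _)) /=.
    by move/asboolP; case.
  split; last by exists y, x, q.
  exists [::], [::] => x1 y1 [x2 [r [/= -> run2 fin2]]].
  by apply/TP; exists p, r.
- move=> k x /actP[lk H]; apply: (prP k lk); exact: (rvP (k, x) H).
Qed.

End TransducerMachine.

Theorem theorem6 (Sigma Omega : finType) (t : seq Sigma -> option (seq Omega)) :
  rational_fun t ->
  suffix_closed (dom t) ->
  let X : pred (seq Sigma) := fun x => isSome (t x) in
  let gamma := growth (suffix_expansion t) X in
  ((~ contains_linear_fooling_set t (dom t) /\ bounded_lang (img t)) ->
     grows_polynomially gamma) /\
  (~ (~ contains_linear_fooling_set t (dom t) /\ bounded_lang (img t)) ->
     grows_exponentially gamma).
Proof.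
move=> [T TP] sc X gamma; have [m] := transducer_machine TP.
split=> [[nf bd]|H].
  have [B0 B0P] := bounded_pair_bound m.
  apply: (expansion_growth (m := m) sc bd (s := tstate2 m B0 (track_bound m B0))).
  - exact: tstate2_cons.
  - exact: tstate2_act.
  - by move=> x a b u v; apply: loop_suffix_indistinct.
have [fool|nf] := pselect (contains_linear_fooling_set t (dom t)).
  exact: fooling_exponential.
apply: contrapT => nexp; apply: H; split=> //.
apply: (commuting_bounded (m := m)) => u v y k lu lv.
apply: contrapT => ne; apply: nexp.
exact: noncommuting_exponential lu lv ne.
Qed.
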